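(* There exists a constant $K>0$ such that for each $N\in\mathbb N$, each $\xi=(u,d)\in\mathcal X_r$ and each $t\in[0,1]$, $$\bigl\|\phi_t\bigl(\rho_N(\xi)\bigr)-\phi_t(\xi)\bigr\|_2\le K\left(\frac1{\sqrt2}\right)^N\bigl(\|\xi\|_{BV}+1\bigr).$$
   Context: Setting. $\mathbb N=\{0,1,2,\dots\}$. Fix positive integers $n,m,q$, put $\mathcal Q=\{1,\dots,q\}$, fix $x_0\in\mathbb R^n$ and a bounded convex set $U\subset\mathbb R^m$. Let $e_1,\dots,e_q$ be the standard basis of $\mathbb R^q$, $\Sigma_r^q=\{d\in[0,1]^q:\sum_{i=1}^q d_i=1\}$ and $\Sigma_p^q=\{e_1,\dots,e_q\}$. For a function $w$ on $[0,1]$ with values in a Euclidean space, $\|w\|_{L^2}=(\int_0^1\|w(t)\|_2^2dt)^{1/2}$, and $\|w\|_{BV}=\sup\sum_{j}\|w(t_{j+1})-w(t_j)\|_1$ (supremum over finite partitions $\{t_j\}$ of $[0,1]$) is its total variation. Let $\mathcal U$, $\mathcal D_r$, $\mathcal D_p$ be the sets of functions in $L^2$ and of bounded variation on $[0,1]$ with values in $U$, $\Sigma_r^q$, $\Sigma_p^q$ respectively; $\mathcal X_r=\mathcal U\times\mathcal D_r$, $\mathcal X_p=\mathcal U\times\mathcal D_p$. For $\xi=(u,d)$, $\|\xi\|_{BV}$ is the total variation of the $\mathbb R^{m+q}$-valued function $(u,d)$. Dynamics. For each $i\in\mathcal Q$, $f(\cdot,\cdot,\cdot,e_i):\mathbb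 R\times\mathbb R^n\times\mathbb R^m\to\mathbb R^n$ is differentiable in $x$ and $u$, and there is $L>0$ such that for $F\in\{f(\cdot,e_i),\frac{\partial f}{\partial x}(\cdot,e_i),\frac{\partial f}{\partial u}(\cdot,e_i)\}$, $\|F(t_1,x_1,u_1)-F(t_2,x_2,u_2)\|\le L(|t_1-t_2|+\|x_1-x_2\|_2+\|u_1-u_2\|_2)$ for all $t_1,t_2\in[0,1]$, $x_1,x_2\in\mathbb R^n$, $u_1,u_2\in U$ (2-norm, resp. induced matrix 2-norm). For $d\in\mathbb R^q$ set $f(t,x,u,d)=\sum_{i=1}^q d_if(t,x,u,e_i)$. For $\xi=(u,d)\in\mathcal X_r$, $x^{(\xi)}:[0,1]\to\mathbb R^n$ is the unique solution of $\dot x(t)=f(t,x(t),u(t),d(t))$, $x(0)=x_0$, and $\phi_t(\xi)=x^{(\xi)}(t)$. Projection. Let $\lambda=1$ on $[0,\frac12)$, $-1$ on $[\frac12,1)$, $0$ elsewhere, and $b_{kj}(t)=\lambda(2^kt-j)$ for $k\in\mathbb N$, $j\in\{0,\dots,2^k-1\}$. For scalar $c\in L^2\cap BV$, $$\mathcal F_N(c)=\langle c,1\rangle+\sum_{k=0}^N\sum_{j=0}^{2^k-1}\langle c,b_{kj}\rangle\frac{b_{kj}}{\|b_{kj}\|_{L^2}^2}$$ (inner product of $L^2([0,1])$); $\mathcal F_N$ acts coordinate-wise on vector-valued functions. The pulse-width modulation $\mathcal P_N:\mathcal D_r\to\mathcal D_p$ is: $[\mathcal P_N(d)]_i(t)=1$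 if $t\in\bigl[2^{-N}(k+\sum_{j=1}^{i-1}d_j(\tfrac k{2^N})),\,2^{-N}(k+\sum_{j=1}^{i}d_j(\tfrac k{2^N}))\bigr)$ for some $k\in\{0,\dots,2^N-1\}$, and $0$ otherwise. Finally $\rho_N(u,d)=\bigl(\mathcal F_N(u),\mathcal P_N(\mathcal F_N(d))\bigr)$. Functions given by such formulas are understood on $[0,1)$ and extended to $t=1$ by their left limit. *)

(* Defs.v *)
From HB Require Import structures.
From mathcomp Require Import all_boot all_order all_algebra.
From mathcomp Require Import all_classical all_reals all_analysis.

Set Implicit Arguments.
Unset Strict Implicit.
Unset Printing Implicit Defensive.

Import Order.TTheory GRing.Theory Num.Theory.
Import numFieldNormedType.Exports.

Local Open Scope classical_set_scope.
Local Open Scope ring_scope.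

(* Vectors are row vectors.  A function on [0, 1] is a total function on [R] of
   which only the values on [0, 1] matter. *)

Section Norms.
Context {R : realType}.

(* The library norm of ['rV_n] is the sup norm, hence these. *)
Definition norm1 n (v : 'rV[R]_n) : R := \sum_(i < n) `|v 0 i|.

Definition norm2 n (v : 'rV[R]_n) : R := Num.sqrt (\sum_(i < n) v 0 i ^+ 2).

(* Matrices act on the right of row vectors, as [jacobian] does. *)
Definition mx_norm2 m n (A : 'M[R]_(m, n)) : R :=
  sup [set norm2 (v *m A) | v in [set v : 'rV[R]_m | norm2 v <= 1]].

End Norms.

Section FunctionsOnUnitInterval.
Context {R : realType}.

Definition L2dot (c g : R -> R) : R :=
  \int[@lebesgue_measure R]_(t in `[0, 1]) (c t * g t).

Definition L2norm (c : R -> R) : R := Num.sqrt (L2dot c c).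

Definition in_L2 n (w : R -> 'rV[R]_n) : Prop :=
  (forall i, measurable_fun (`[0, 1] : set R) (fun t : R => w t 0 i : R)) /\
  (\int[@lebesgue_measure R]_(t in `[0%R, 1%R]) (norm2 (w t) ^+ 2)%:E < +oo)%E.

(* As in the library's real-valued [variations], the partition
   0 < t_1 < ... < t_l = 1 is the sequence [:: t_1; ...; t_l]. *)
Definition vvariations n (w : R -> 'rV[R]_n) : set R :=
  [set \sum_(j < size s) norm1 (w (nth 1 (0 :: s) j.+1) - w (nth 1 (0 :: s) j))
  | s in itv_partition 0 1].

Definition in_BV n (w : R -> 'rV[R]_n) : Prop := has_ubound (vvariations w).

(* Total variation; meaningful when [in_BV w] holds. *)
Definition BVnorm n (w : R -> 'rV[R]_n) : R := sup (vvariations w).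

Definition abs_continuous n (w : R -> 'rV[R]_n) : Prop :=
  forall e : R, 0 < e -> exists2 delta : R, 0 < delta &
    forall (l : nat) (a b : 'I_l -> R),
      (forall i, [/\ 0 <= a i, a i <= b i & b i <= 1]) ->
      (forall i j, i != j -> b i <= a j \/ b j <= a i) ->
      \sum_i (b i - a i) < delta ->
      \sum_i norm2 (w (b i) - w (a i)) < e.

(* For a [c] given by a formula valid on [0, 1): the value at 1 becomes the left
   limit. *)
Definition extend_left (c : R -> R) (t : R) : R :=
  if t == 1 then lim (c s @[s --> 1^'-]) else c t.

End FunctionsOnUnitInterval.

Section Controls.
Context {R : realType}.

Definition Sigma_r q : set 'rV[R]_q :=
  [set d | (forall i, 0 <= d 0 i <= 1) /\ \sum_(i < q) d 0 i = 1].

Definition controls n (A : set 'rV[R]_n) : set (R -> 'rV[R]_n) :=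
  [set w | [/\ forall t, 0 <= t <= 1 -> A (w t), in_L2 w & in_BV w]].

Definition Xr m q (U : set 'rV[R]_m) :
    set ((R -> 'rV[R]_m) * (R -> 'rV[R]_q)) :=
  controls U `*` controls (@Sigma_r q).

Definition BVnorm_pair m q (xi : (R -> 'rV[R]_m) * (R -> 'rV[R]_q)) : R :=
  BVnorm (fun t => row_mx (xi.1 t) (xi.2 t)).

End Controls.

Section Dynamics.
Context {R : realType} (n m q : nat).
Implicit Types (f : 'I_q -> R -> 'rV[R]_n -> 'rV[R]_m -> 'rV[R]_n).

Definition lipschitz_data (V : zmodType) (nrm : V -> R) (U : set 'rV[R]_m)
    (L : R) (F : R -> 'rV[R]_n -> 'rV[R]_m -> V) : Prop :=
  forall t1 t2 x1 x2 u1 u2,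
    0 <= t1 <= 1 -> 0 <= t2 <= 1 -> U u1 -> U u2 ->
    nrm (F t1 x1 u1 - F t2 x2 u2) <=
      L * (`|t1 - t2| + norm2 (x1 - x2) + norm2 (u1 - u2)).

(* [f i] is f(., ., ., e_i). *)
Definition vector_field f (t : R) (x : 'rV[R]_n) (u : 'rV[R]_m)
    (d : 'rV[R]_q) : 'rV[R]_n :=
  \sum_(i < q) d 0 i *: f i t x u.

(* The controls are discontinuous in general, so that the differential equation
   is understood in the sense of Caratheodory. *)
Definition is_trajectory f (x0 : 'rV[R]_n)
    (xi : (R -> 'rV[R]_m) * (R -> 'rV[R]_q)) (x : R -> 'rV[R]_n) : Prop :=
  [/\ x 0 = x0,
      abs_continuous x &
      {ae @lebesgue_measure R, forall t : R, 0 <= t <= 1 ->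
        is_derive t 1 x (vector_field f t (x t) (xi.1 t) (xi.2 t))}].

(* The trajectory is unique on [0, 1], its values elsewhere are irrelevant, and
   the default 0 is never used for admissible [xi]. *)
Definition phi f (x0 : 'rV[R]_n) (t : R)
    (xi : (R -> 'rV[R]_m) * (R -> 'rV[R]_q)) : 'rV[R]_n :=
  xget (cst 0) [set x : R -> 'rV[R]_n | is_trajectory f x0 xi x] t.

End Dynamics.

Section Projection.
Context {R : realType}.

Definition haar_mother (t : R) : R :=
  if 0 <= t < 2^-1 then 1 else if 2^-1 <= t < 1 then -1 else 0.

Definition haar (k j : nat) (t : R) : R := haar_mother (2 ^+ k * t - j%:R).

Definition haar_sum (N : nat) (c : R -> R) (t : R) : R :=
  L2dot c (cst 1) +
  \sum_(0 <= k < N.+1) \sum_(0 <= j < 2 ^ k)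
    L2dot c (haar k j) * (haar k j t / L2norm (haar k j) ^+ 2).

Definition haar_proj (N : nat) n (w : R -> 'rV[R]_n) (t : R) : 'rV[R]_n :=
  \row_i extend_left (haar_sum N (fun s => w s 0 i)) t.

Definition pulse (N q : nat) (d : R -> 'rV[R]_q) (i : 'I_q) (t : R) : R :=
  if [exists k : 'I_(2 ^ N),
       2 ^- N * (k%:R + \sum_(j < q | (j < i)%N) d (k%:R / 2 ^+ N) 0 j) <= t <
       2 ^- N * (k%:R + \sum_(j < q | (j <= i)%N) d (k%:R / 2 ^+ N) 0 j)]
  then 1 else 0.

Definition pwm (N q : nat) (d : R -> 'rV[R]_q) (t : R) : 'rV[R]_q :=
  \row_i extend_left (pulse N d i) t.

Definition rho (N m q : nat) (xi : (R -> 'rV[R]_m) * (R -> 'rV[R]_q)) :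
    (R -> 'rV[R]_m) * (R -> 'rV[R]_q) :=
  (haar_proj N xi.1, pwm N (haar_proj N xi.2)).

End Projection.

(* Main.v *)
Require Import Defs.
From HB Require Import structures.
From mathcomp Require Import all_boot all_order all_algebra.
From mathcomp Require Import all_classical all_reals all_analysis.
From mathcomp Require Import measurable_realfun.
From mathcomp Require Import ring lra.
Import Order.TTheory GRing.Theory Num.Theory.
Import numFieldNormedType.Exports.
Set Implicit Arguments.
Unset Strict Implicit.
Unset Printing Implicit Defensive.
Local Open Scope classical_set_scope.
Local Open Scope ring_scope.

(** The discretized control differs from the original one by an error that is
small in two different senses, and the flow is insensitive to both.

- The continuous component is replaced by its averages over the [2 ^ N.+1]
  dyadic cells: this is what the Haar partial sum computes
  ([haar_proj_average]).  On a cell the average is off by at most the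
  variation over that cell, so the [L^1] error is at most [2 ^ - N] times the
  total variation ([cell_mean_L1]).
- The switching component becomes a sequence of pulses, which is not close to
  the original in [L^1].  It is close weakly: over each of the [2 ^ N] cells
  the pulses and the original have almost the same integral
  ([pulse_cell_error]), so that integrating the difference against a function
  [g] of bounded variation costs only the oscillations of [g] over the cells,
  in total [2 ^ - N] times the variation of [g] ([weak_estimate]).  Here [g] is
  a coordinate of the vector field along the original trajectory; it is of
  bounded variation since the trajectory is Lipschitz, with a constant that
  does not depend on the control, and the field is Lipschitz in the rest.

Moving along the original trajectory, the two vector fields therefore have
integrals that differ by [O(2 ^ - N * (BVnorm_pair xi + 1))]; a Gronwall
argument carries this over to the trajectories ([stability]), and
[2 ^ - N <= (1 / sqrt 2) ^ N].

Three points need care.  First, [phi] selects some absolutely continuous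
solution, so existence has to be shown, and every such solution has to be
recognized as a fixed point of the integral operator [picard].  Existence is
Picard iteration for a sup norm with exponential weight, for which [picard] is
a contraction of ratio 1/2 ([picard_contraction], [picard_fixpoint]); the
recognition rests on the fact that an absolutely continuous function whose
derivative is bounded by [B] almost everywhere is [B]-Lipschitz
([abs_continuous_bounded_derive_lip]).  Secondly, the discretized control must
stay where the Lipschitz bound of the field holds.  The averages of a
[U]-valued function are limits of Riemann sums, hence lie in the closure of
[U] ([average_closure]), and the bound extends to the closure because the
field is continuous in the control ([sup_lipschitz_closure]).  Thirdly, the value of the
discretized control at time 1 is irrelevant, a single point being negligible
([phi_eq_ae]).

Bounded variation is used throughout in the form of a dominating monotone
function [v], that is [|w t - w s| <= v t - v s] for [s <= t]
([variation_bound]): sums of oscillations over cells then telescope.  All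
estimates use the sup norm of row vectors, for which vector integrals are
handled one coordinate at a time; the Euclidean norm enters only at the two
ends, through [norm_le_norm2] and [norm2_le_norm]. *)

(** * Integrals of bounded measurable functions on the unit interval *)

Section Integrals.
Context {R : realType}.
Implicit Types (f g : R -> R) (a b c s t M : R).
Local Notation mu := (@lebesgue_measure R).
Local Notation Int a b g := (\int[mu]_(s in `[a, b]) g s).

Definition bounded_measurable g :=
  measurable_fun (`[0, 1] : set R) g /\
  exists M, forall s, 0 <= s <= 1 -> `|g s| <= M.

Lemma bounded_measurable_cst c : bounded_measurable (cst c).
Proof. by split; [exact: measurable_cst|exists `|c|]. Qed.

Lemma bounded_measurableD f g : bounded_measurable f -> bounded_measurable g ->
  bounded_measurable (fun s => f s + g s).
Proof.
move=> [mf [M fM]] [mg [M' gM]]; split; first exact: measurable_funD.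
exists (M + M') => s s01; rewrite (le_trans (ler_normD _ _))// lerD ?fM ?gM//.
Qed.

Lemma bounded_measurableM f g : bounded_measurable f -> bounded_measurable g ->
  bounded_measurable (fun s => f s * g s).
Proof.
move=> [mf [M fM]] [mg [M' gM]]; split; first exact: measurable_funM.
by exists (M * M') => s s01; rewrite normrM ler_pM ?fM ?gM.
Qed.

Lemma bounded_measurableB f g : bounded_measurable f -> bounded_measurable g ->
  bounded_measurable (fun s => f s - g s).
Proof.
move=> [mf [M fM]] [mg [M' gM]]; split; first exact: measurable_funB.
exists (M + M') => s s01; rewrite (le_trans (ler_normB _ _))// lerD ?fM ?gM//.
Qed.

Lemma bounded_measurable_norm f : bounded_measurable f ->
  bounded_measurable (fun s => `|f s|).
Proof.
move=> [mf [M fM]]; split; first exact: measurableT_comp.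
by exists M => s s01; rewrite normr_id fM.
Qed.

Lemma bounded_measurable_sum I (r : seq I) (P : pred I) (F : I -> R -> R) :
  (forall i, bounded_measurable (F i)) ->
  bounded_measurable (fun s => \sum_(i <- r | P i) F i s).
Proof.
move=> hF; elim: r => [|i r IH].
  by under eq_fun do rewrite big_nil; exact: bounded_measurable_cst.
under eq_fun do rewrite big_cons.
by case: (P i) => //; apply: bounded_measurableD.
Qed.

Lemma eq_bounded_measurable f g : (forall s, 0 <= s <= 1 -> f s = g s) ->
  bounded_measurable f -> bounded_measurable g.
Proof.
move=> fg [mf [M fM]]; split; last by exists M => s s01; rewrite -fg// fM.
apply: eq_measurable_fun mf => s; rewrite inE/= in_itv/=; exact: fg.
Qed.

Lemma integrable_bounded_measurable g a b : 0 <= a -> b <= 1 ->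
  bounded_measurable g -> mu.-integrable `[a, b] (EFin \o g).
Proof.
move=> a0 b1 [mg [M gM]].
have sub : `[a, b] `<=` (`[0, 1] : set R).
  by move=> s /=; rewrite !in_itv/= => /andP[/(le_trans a0)-> /le_trans->].
apply: measurable_bounded_integrable => //=.
- by rewrite lebesgue_measure_itv/=; case: ifP => _; rewrite ?ltry// -EFinD ltry.
- exact: measurable_funS mg.
exists M; split; first exact: num_real.
move=> r Mr s /sub /=; rewrite in_itv/= => s01.
by rewrite (le_trans (gM _ s01))// ltW.
Qed.

Lemma IntD f g a b : 0 <= a -> b <= 1 ->
  bounded_measurable f -> bounded_measurable g ->
  Int a b (fun s => f s + g s) = Int a b f + Int a b g.
Proof. by move=> a0 b1 bf bg; apply: RintegralD => //; exact: integrable_bounded_measurable. Qed.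

Lemma IntB f g a b : 0 <= a -> b <= 1 ->
  bounded_measurable f -> bounded_measurable g ->
  Int a b (fun s => f s - g s) = Int a b f - Int a b g.
Proof. by move=> a0 b1 bf bg; apply: RintegralB => //; exact: integrable_bounded_measurable. Qed.

Lemma IntZ c g a b : 0 <= a -> b <= 1 -> bounded_measurable g ->
  Int a b (fun s => c * g s) = c * Int a b g.
Proof. by move=> a0 b1 bg; apply: RintegralZl => //; exact: integrable_bounded_measurable. Qed.

Lemma Int_sum I (r : seq I) (P : pred I) (F : I -> R -> R) a b :
  0 <= a -> b <= 1 -> (forall i, bounded_measurable (F i)) ->
  Int a b (fun s => \sum_(i <- r | P i) F i s) =
  \sum_(i <- r | P i) Int a b (F i).
Proof.
move=> a0 b1 hF; elim: r => [|i r IH].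
  rewrite big_nil; under eq_Rintegral do rewrite big_nil.
  by rewrite Rintegral_cst// mul0r.
rewrite big_cons; under eq_Rintegral do rewrite big_cons.
case: (P i) => //; rewrite -IH -IntD//.
exact: (bounded_measurable_sum r P hF).
Qed.

Lemma Int_cst c a b : a <= b -> Int a b (cst c) = c * (b - a).
Proof.
move=> ab; rewrite Rintegral_cst//= lebesgue_measure_itv/= lte_fin.
by move: ab; rewrite le_eqVlt => /predU1P[->|->//]; rewrite ltxx subrr.
Qed.

Lemma Int_point g a : Int a a g = 0.
Proof. by rewrite set_itv1 Rintegral_set1. Qed.

(** The hypothesis stops short of the right endpoint, as the functions to be
compared (Haar functions, pulses, cell averages) are described on half-open
cells. *)
Lemma Int_le f g a b : 0 <= a -> b <= 1 ->
  bounded_measurable f -> bounded_measurable g ->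
  (forall s, a <= s < b -> f s <= g s) -> Int a b f <= Int a b g.
Proof.
move=> a0 b1 bf bg fg.
have sub : (`[a, b[ : set R) `<=` (`[a, b] : set R).
  by move=> s /=; rewrite !in_itv/= => /andP[-> /ltW].
have bi h : bounded_measurable h -> mu.-integrable `[a, b[ (EFin \o h).
  by move=> bh; apply: (@integrableS _ _ _ mu `[a, b]) => //; exact: integrable_bounded_measurable.
rewrite -!Rintegral_itv_bndo_bndc ?bi//; apply: le_Rintegral => //; exact: bi.
Qed.

Lemma eq_Int f g a b : 0 <= a -> b <= 1 ->
  bounded_measurable f -> bounded_measurable g ->
  (forall s, a <= s < b -> f s = g s) -> Int a b f = Int a b g.
Proof.
by move=> a0 b1 bf bg fg; apply/eqP; rewrite eq_le !Int_le// => s /fg->.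
Qed.

Lemma Int_norm_le g a b M : 0 <= a -> a <= b -> b <= 1 -> bounded_measurable g ->
  (forall s, a <= s < b -> `|g s| <= M) -> `|Int a b g| <= M * (b - a).
Proof.
move=> a0 ab b1 bg gM; rewrite ler_norml; apply/andP; split.
  rewrite -mulNr -Int_cst//; apply: Int_le => //; first exact: bounded_measurable_cst.
  by move=> s /gM; rewrite ler_norml => /andP[].
rewrite -Int_cst//; apply: Int_le => //; first exact: bounded_measurable_cst.
by move=> s /gM; rewrite ler_norml => /andP[].
Qed.

Lemma Int_norm_le_Int f g a b : 0 <= a -> b <= 1 ->
  bounded_measurable f -> bounded_measurable g ->
  (forall s, a <= s < b -> `|g s| <= f s) -> `|Int a b g| <= Int a b f.
Proof.
move=> a0 b1 bf bg gf; rewrite ler_norml; apply/andP; split.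
  rewrite -mulN1r -IntZ//; apply: Int_le => //.
    exact: (bounded_measurableM (bounded_measurable_cst _) bf).
  by move=> s /gf; rewrite ler_norml mulN1r => /andP[].
by apply: Int_le => // s /gf; rewrite ler_norml => /andP[].
Qed.

Lemma Int_split g a b c : 0 <= a -> a <= b -> b <= c -> c <= 1 ->
  bounded_measurable g -> Int a c g = Int a b g + Int b c g.
Proof.
move=> a0 ab bc c1 bg.
have b0 := le_trans a0 ab.
have ig := integrable_bounded_measurable a0 c1 bg.
have := @Rintegral_itvB R g (BLeft a) (BRight c) b ig.
rewrite !bnd_simp => /(_ ab bc) H.
rewrite -[Int b c g]Rintegral_itv_obnd_cbnd -?H 1?addrC ?subrK//.
apply: (@integrableS _ _ _ mu `[b, c]) => //; last exact: integrable_bounded_measurable.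
by move=> s /=; rewrite !in_itv/= => /andP[/ltW->].
Qed.

End Integrals.

(** * Absolutely continuous functions with bounded derivative *)

Section AbsoluteContinuity.
Context {R : realType}.
Local Notation mu := (@lebesgue_measure R).

(** A form of the compactness of a segment (Cousin's lemma): with [P] additive,
the supremum of the [t] with [P a t] cannot lie before [b]. *)
Lemma interval_induction (P : R -> R -> Prop) (a b : R) : a <= b ->
  (forall s t u, a <= s -> s <= t -> t <= u -> u <= b ->
     P s t -> P t u -> P s u) ->
  (forall t, a <= t <= b -> exists2 r, 0 < r &
     forall s u, a <= s -> s <= t -> t <= u -> u <= b ->
       t - r < s -> u < t + r -> P s u) ->
  P a b.
Proof.
move=> ab Padd Ploc.
pose S := [set t | a <= t <= b /\ P a t].
have Sa : S a.
  split; first by rewrite lexx.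
  have [|r r0 Pr] := Ploc a; first by rewrite lexx.
  by apply: Pr => //; lra.
have supS : has_sup S by split; [exists a|exists b => t [/andP[]]].
have ac : a <= sup S by apply: ub_le_sup => //; exact: supS.2.
have cb : sup S <= b by apply: ge_sup; [exists a|move=> t [/andP[]]].
have [r r0 Pr] := Ploc (sup S) (introT andP (conj ac cb)).
have [t [/andP[at_ tb] Pat] tc] := sup_adherent r0 supS.
have tS : t <= sup S by apply: ub_le_sup; [exact: supS.2|split; rewrite ?at_].
pose u := Num.min (sup S + r / 2) b.
have cu : sup S <= u by rewrite le_min cb andbT; lra.
have ub : u <= b by rewrite ge_min lexx orbT.
have ur : u < sup S + r by rewrite gt_min; apply/orP; left; lra.
have Pau : P a u.
  apply: (Padd a t u) => //; [by lra|by apply: Pr => //; lra].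
have : u <= sup S.
  apply: ub_le_sup; first exact: supS.2.
  by split => //; rewrite ub andbT (le_trans ac).
rewrite /u ge_min => /orP[H|bc]; first by lra.
by rewrite (_ : b = u)//; apply: le_anti; rewrite ub (le_trans bc).
Qed.

Definition scalar_abs_continuous (y : R -> R) := forall e : R, 0 < e ->
  exists2 delta : R, 0 < delta &
    forall (l : nat) (a b : 'I_l -> R),
      (forall i, [/\ 0 <= a i, a i <= b i & b i <= 1]) ->
      (forall i j, i != j -> b i <= a j \/ b j <= a i) ->
      \sum_i (b i - a i) < delta ->
      \sum_i `|y (b i) - y (a i)| < e.

Lemma scalar_abs_continuous_seq y : scalar_abs_continuous y ->
  forall e : R, 0 < e -> exists2 delta : R, 0 < delta &
    forall l : seq (R * R),
      (forall p, p \in l -> [/\ 0 <= p.1, p.1 <= p.2 & p.2 <= 1]) ->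
      pairwise (fun p q => p.2 <= q.1) l ->
      \sum_(p <- l) (p.2 - p.1) < delta ->
      \sum_(p <- l) `|y p.2 - y p.1| < e.
Proof.
move=> acy e e0; have [d d0 H] := acy _ e0; exists d => // l l01 lpw.
rewrite !(big_nth (0, 0)) !big_mkord => ld.
apply: (H _ (fun i => (nth (0, 0) l i).1) (fun i => (nth (0, 0) l i).2)) => //.
  by move=> i; apply: l01; exact: mem_nth.
move=> i j ij; have /(pairwiseP (0, 0)) lp := lpw.
have [ltij|ltji|/val_inj eij] := ltngtP i j.
- by left; apply: lp; rewrite ?inE.
- by right; apply: lp; rewrite ?inE.
- by rewrite eij eqxx in ij.
Qed.

(** Near a point of differentiability the slope of [y] exceeds the derivative by
at most [e]. *)
Lemma is_derive_local_bound (y : R -> R) (t D B e : R) : is_derive t 1 y D ->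
  `|D| <= B -> 0 < e -> exists2 r, 0 < r & forall s, `|s - t| < r ->
    `|y s - y t| <= (B + e) * `|s - t|.
Proof.
move=> [dy Dy] DB e0; have := dy; rewrite /derivable /= => /cvgrPdist_le /= H.
have {H} := H _ e0; rewrite -/(derive y t 1) Dy => -[r /= r0 H].
exists r => // s st.
have [->|nst] := eqVneq s t; first by rewrite !subrr normr0 mulr0.
have st0 : s - t != 0 by rewrite subr_eq0.
have := H (s - t); rewrite /ball_/= sub0r normrN => /(_ st st0).
rewrite [X in y X](_ : _ = s); last by rewrite /GRing.scale/= mulr1 subrK.
set q := _ *: _ => Hq.
have -> : y s - y t = (s - t) * q by rewrite /q /GRing.scale/= mulVKf.
rewrite normrM mulrC ler_wpM2r//.
rewrite (le_trans _ (lerD DB Hq))//.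
by rewrite -[X in `|X| <= _](subKr D) ler_normB.
Qed.

(** Cover the exceptional null set by an open set [U] of measure less than the
[delta] of absolute continuity for [e / 2].  Every point is the centre of small
intervals which either lie in [U] or have slope at most [B + e / 2]; by
[interval_induction] finitely many of them fill the interval from [a] to [b].  Those in [U] have
total length less than [delta], hence contribute at most [e / 2]. *)
Lemma abs_continuous_bounded_derive_lip (y : R -> R) (B : R) :
  0 <= B -> scalar_abs_continuous y ->
  {ae mu, forall t : R, 0 <= t <= 1 ->
     exists2 D : R, is_derive t 1 y D & `|D| <= B} ->
  forall a b, 0 <= a -> a <= b -> b <= 1 -> `|y b - y a| <= B * (b - a).
Proof.
move=> B0 acy [Z [mZ Z0' subZ]] a b a0 ab b1.
pose lm : {measure set (measurableTypeR R) -> \bar R} := @lebesgue_measure R.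
have Z0 : lm Z = 0%E := Z0'.
apply/ler_addgt0Pl => e e0; have e20 : 0 < e / 2 by lra.
have [d d0 Hd] := scalar_abs_continuous_seq acy e20.
have [U [oU ZU muUZ]] : exists U, [/\ open U, Z `<=` U & (lm (U `\` Z) < d%:E)%E].
  by apply: lebesgue_regularity_outer => //; rewrite -[X in (X < _)%E]/(lm Z) Z0 ltry.
have mU : measurable U by exact: open_measurable.
have muU : (lm U < d%:E)%E.
  have H : (lm (Z `|` (U `\` Z)) <= lm Z + lm (U `\` Z))%E.
    by apply: measureU2 => //; exact: measurableD.
  by move: H; rewrite Z0 add0e setDUK// => /le_lt_trans; apply.
(* [m] measures the part of [U] before [t]; its increments bound the lengths of
   intervals contained in [U], so that disjoint such intervals need no separate
   treatment. *)
pose m t := fine (lm (U `&` `]-oo, t[)).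
have mUt t : measurable (U `&` `]-oo, t[ : set R) by exact: measurableI.
have lmS (A C : set R) : measurable A -> measurable C -> A `<=` C -> (lm A <= lm C)%E.
  by move=> mA mC AC; apply: le_measure => //; exact: mem_set.
have leU t : (lm (U `&` `]-oo, t[) <= lm U)%E.
  by apply: lmS => //; exact: subIsetl.
have fin t : lm (U `&` `]-oo, t[) \is a fin_num.
  rewrite ge0_fin_numE// (le_lt_trans (leU t))// (lt_trans muU)//; exact: ltry.
have m_mono s t : s <= t -> m s <= m t.
  move=> st; apply: fine_le => //; apply: lmS => //.
  by apply: setIS => u /=; rewrite !in_itv/= => /lt_le_trans; apply.
have m_itv s t : s <= t -> [set` `[s, t[] `<=` U -> t - s <= m t - m s.
  move=> st stU; rewrite lerBrDr -lee_fin EFinD.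
  have lm_st : lm [set` `[s, t[] = (t - s)%:E.
    apply: etrans (lebesgue_measure_itv `[s, t[) _.
    by rewrite /= lte_fin; case: ltgtP st => // ->; rewrite subrr.
  rewrite /m !fineK// -lm_st.
  have disj : [set` `[s, t[] `&` (U `&` [set` `]-oo, s[]) = set0.
    rewrite -subset0 => u [] /=; rewrite in_itv/= => /andP[su _] [_].
    by rewrite in_itv/= ltNge su.
  rewrite -(measureU lm _ (mUt s) disj)//.
  apply: lmS => //; first exact: measurableU.
  move=> u [|[Uu]] /=; rewrite !in_itv/=.
    by move=> /andP[su ut]; split => //; apply: stU; rewrite /= in_itv/= su.
  by move=> us; split => //; exact: lt_le_trans st.
have m_U s : m s < d.
  by rewrite -lte_fin /m fineK// (le_lt_trans (leU s)).
have m_ge0 s : 0 <= m s by exact: fine_ge0.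
(* the interval from [s] to [u] is filled by finitely many intervals, of which [l] lists those that
   lie in [U]. *)
pose P s u := exists l : seq (R * R),
  [/\ forall p, p \in l -> [/\ s <= p.1, p.1 <= p.2 & p.2 <= u],
      pairwise (fun p q => p.2 <= q.1) l,
      \sum_(p <- l) (p.2 - p.1) <= m u - m s &
      `|y u - y s| <= (B + e / 2) * (u - s) + \sum_(p <- l) `|y p.2 - y p.1|].
have : P a b.
  apply: interval_induction ab _ _.
  - move=> s t u as_ st tu ub [l1 [l1m l1p l1s l1y]] [l2 [l2m l2p l2s l2y]].
    exists (l1 ++ l2); split.
    + move=> p; rewrite mem_cat => /orP[/l1m|/l2m] [? ? ?]; split => //.
        exact: le_trans tu.
      exact: le_trans st _.
    + rewrite pairwise_cat l1p l2p !andbT; apply/allrelP => p q /l1m[_ _ pt].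
      by move=> /l2m[tq _ _]; exact: le_trans tq.
    + by rewrite big_cat/=; lra.
    + rewrite big_cat/= -(subrKA (y t)).
      rewrite (le_trans (ler_normD _ _))// (le_trans (lerD l2y l1y))//.
      lra.
  - move=> t /andP[at_ tb]; have [Ut|nUt] := pselect (U t).
      have /nbhs_ballP[r /= r0 rU] : nbhs t U by exact: open_nbhs_nbhs.
      exists r => // s u as_ st tu ub tr ur.
      exists [:: (s, u)]; rewrite !big_seq1/=; split => //.
      - by move=> p; rewrite inE => /eqP->/=; rewrite !lexx (le_trans st tu).
      - apply: m_itv; first exact: le_trans tu.
        move=> x /=; rewrite in_itv/= => /andP[sx xu]; apply: rU.
        rewrite /ball/= ltr_norml; lra.
      - by rewrite lerDr mulr_ge0//; lra.
    have nt : ~ Z t by move=> /ZU.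
    have /contrapT goodt : ~ ~ (0 <= t <= 1 ->
        exists2 D : R, is_derive t 1 y D & `|D| <= B).
      exact: contra_not (subZ t) nt.
    have [|D dD DB] := goodt; first by rewrite (le_trans a0)//= (le_trans tb).
    have [r r0 Hr] := is_derive_local_bound dD DB e20.
    exists r => // s u as_ st tu ub tr ur.
    exists [::]; rewrite !big_nil; split => //.
      by rewrite subr_ge0; apply: m_mono; exact: le_trans tu.
    rewrite addr0 -(subrKA (y t)) (le_trans (ler_normD _ _))//.
    rewrite (distrC (y t)).
    have -> : u - s = `|u - t| + `|s - t|.
      by rewrite ger0_norm ?subr_ge0// ler0_norm ?subr_le0//; lra.
    rewrite mulrDr lerD// Hr//.
      by rewrite ger0_norm ?subr_ge0//; lra.
    by rewrite ler0_norm ?subr_le0//; lra.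
move=> [l [lin lp ls ly]].
have {}Hd : \sum_(p <- l) `|y p.2 - y p.1| < e / 2.
  apply: Hd => //.
    by move=> p /lin[? ? ?]; split => //; [exact: le_trans a0 _|exact: le_trans b1].
  by rewrite (le_lt_trans ls)//; have := m_U b; have := m_ge0 a; lra.
have : (e / 2) * (b - a) <= e / 2 by rewrite -[leRHS]mulr1 ler_pM2l//; lra.
move: ly; rewrite mulrDl; lra.
Qed.

End AbsoluteContinuity.

(** * The fundamental theorem of calculus for bounded integrands *)

Section FundamentalTheorem.
Context {R : realType}.
Local Notation mu := (@lebesgue_measure R).
Local Notation Int a b g := (\int[mu]_(s in `[a, b]) g s).

Lemma ae_neq (c : R) : {ae mu, forall t : R, t <> c}.
Proof.
exists [set c]; split => //; first exact: lebesgue_measure_set1.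
by move=> t /= /contrapT.
Qed.

Lemma ae_and2 (P Q S : R -> Prop) : (forall t, P t -> Q t -> S t) ->
  {ae mu, forall t, P t} -> {ae mu, forall t, Q t} -> {ae mu, forall t, S t}.
Proof.
move=> H; apply: filterS2; last exact: H.
exact: (ae_filter_ringOfSetsType mu).
Qed.

(** Almost every point is a Lebesgue point of [g] cut off outside the unit interval,
which is locally integrable; there [FTC1_lebesgue_pt] applies, except at the
two endpoints, which are negligible. *)
Lemma ae_is_derive_Int g : bounded_measurable g ->
  {ae mu, forall t : R, 0 <= t <= 1 -> is_derive t 1 (fun s => Int 0 s g) (g t)}.
Proof.
move=> bg; have ig := integrable_bounded_measurable (lexx 0) (lexx 1) bg.
pose f := g \_ [set` `[0, 1]].
have itf : mu.-integrable setT (EFin \o f).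
  by rewrite -restrict_EFin; apply/(integrable_mkcond _ _).1.
have locf : locally_integrable setT f.
  by apply: open_integrable_locally => //; exact: openT.
have ae01 := ae_and2 (fun t a b => conj a b) (ae_neq 0) (ae_neq 1).
apply: ae_and2 ae01 (lebesgue_differentiation locf) => t /= [nt0 t1] Lt /andP[t0' t1'].
have {nt0} t0 : 0 < t by rewrite lt_neqAle t0' andbT eq_sym; exact/eqP.
have {t1 t1'} t1 : t < 1 by rewrite lt_neqAle t1' andbT; exact/eqP.
have [] := @FTC1_lebesgue_pt R f (BLeft 0) t 1 t1 _ _ Lt.
- exact: integrableS itf.
- by rewrite lte_fin.
set F := fun y => _ => dF DF.
have Ft : is_derive t 1 F (g t).
  apply: DeriveDef => //; rewrite -derive1E DF /f patchE mem_set//=.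
  by rewrite in_itv/= t0' ltW.
apply: near_eq_is_derive Ft.
near=> s; rewrite /F; apply: eq_Rintegral => x; rewrite inE/= in_itv/= => /andP[x0 xs].
rewrite /f patchE mem_set//= in_itv/= x0 (le_trans xs)//.
by near: s; exact: lt_le_nbhsl.
Unshelve. all: by end_near. Qed.

Lemma scalar_abs_continuous_lip (y : R -> R) M :
  (forall s t, 0 <= s -> s <= t -> t <= 1 -> `|y t - y s| <= M * (t - s)) ->
  scalar_abs_continuous y.
Proof.
move=> yM e e0; have M0 : 0 < `|M| + 1 by rewrite ltr_pwDr.
exists (e / (`|M| + 1)); first exact: divr_gt0.
move=> l a b ab _; rewrite ltr_pdivlMr// mulrC => /(le_lt_trans _); apply.
rewrite mulr_sumr; apply: ler_sum => i _; have [a0 aib b1] := ab i.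
rewrite (le_trans (yM _ _ a0 aib b1))// ler_wpM2r ?subr_ge0//.
by rewrite (le_trans (ler_norm M))// lerDl.
Qed.

Lemma scalar_abs_continuousB (y z : R -> R) :
  scalar_abs_continuous y -> scalar_abs_continuous z ->
  scalar_abs_continuous (fun t => y t - z t).
Proof.
move=> acy acz e e0; have e20 : 0 < e / 2 by lra.
have [d1 d10 H1] := acy _ e20; have [d2 d20 H2] := acz _ e20.
exists (Num.min d1 d2); first by rewrite lt_min d10.
move=> l a b ab dis; rewrite lt_min => /andP[/(H1 _ _ _ ab dis) {}H1].
move=> /(H2 _ _ _ ab dis) {}H2.
have -> : e = e / 2 + e / 2 by lra.
apply: le_lt_trans (ltrD H1 H2).
rewrite -big_split/=; apply: ler_sum => i _.
by rewrite (_ : _ - _ = (y (b i) - y (a i)) - (z (b i) - z (a i))) ?ler_normB//; lra.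
Qed.

Lemma Int_lip g M : bounded_measurable g ->
  (forall s, 0 <= s <= 1 -> `|g s| <= M) ->
  forall s t, 0 <= s -> s <= t -> t <= 1 ->
    `|Int 0 t g - Int 0 s g| <= M * (t - s).
Proof.
move=> bg gM s t s0 st t1; rewrite (@Int_split R g 0 s t)// addrAC subrr add0r.
by apply: Int_norm_le => // r rst; apply: gM; lra.
Qed.

(** The difference of both sides is absolutely continuous with derivative 0 almost
everywhere, hence constant. *)
Lemma abs_continuous_Int (y g : R -> R) : bounded_measurable g ->
  scalar_abs_continuous y ->
  {ae mu, forall t : R, 0 <= t <= 1 -> is_derive t 1 y (g t)} ->
  forall t, 0 <= t <= 1 -> y t = y 0 + Int 0 t g.
Proof.
move=> bg acy dy t /andP[t0 t1].
have [_ [M gM]] := bg.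
have acI := scalar_abs_continuous_lip (Int_lip bg gM).
have := @abs_continuous_bounded_derive_lip R (fun s => y s - Int 0 s g) 0 (lexx 0)
  (scalar_abs_continuousB acy acI).
have dI := ae_is_derive_Int bg.
have dz : {ae mu, forall t : R, 0 <= t <= 1 ->
    exists2 D : R, is_derive t 1 (fun s => y s - Int 0 s g) D & `|D| <= 0}.
  apply: ae_and2 dy dI => s ys Is s01; exists (g s - g s).
    by have := ys s01; have := Is s01 => ? ?; exact: is_deriveB.
  by rewrite subrr normr0.
move=> /(_ dz 0 t (lexx _) t0 t1); rewrite mul0r Int_point subr0 normr_le0.
by rewrite subr_eq0 => /eqP <-; rewrite subrK.
Qed.

End FundamentalTheorem.

(** * The sup norm and the Euclidean norm of row vectors *)

Section RowNorms.
Context {R : realType}.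

Lemma rV_norm_le n (x : 'rV[R]_n) (B : R) : 0 <= B ->
  (forall l, `|x 0 l| <= B) -> `|x| <= B.
Proof.
move=> B0 xB; rewrite /Num.Def.normr/= mx_normrE (bigmax_le _ B0)//= => -[i l] _.
by rewrite ord1.
Qed.

Lemma rV_coord_le n (x : 'rV[R]_n) l : `|x 0 l| <= `|x|.
Proof.
rewrite [leRHS]/Num.Def.normr/= mx_normrE.
exact: (le_bigmax _ (fun ij => `|x ij.1 ij.2|) (0, l)).
Qed.

Lemma norm_le_norm2 n (x : 'rV[R]_n) : `|x| <= norm2 x.
Proof.
apply: rV_norm_le; first exact: sqrtr_ge0.
move=> l; rewrite -sqrtr_sqr /norm2 ler_sqrt; last by apply: sumr_ge0 => i _; exact: sqr_ge0.
by rewrite (bigD1 l)//= lerDl; apply: sumr_ge0 => i _; exact: sqr_ge0.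
Qed.

Lemma norm2_le_norm n (x : 'rV[R]_n) : norm2 x <= n%:R * `|x|.
Proof.
rewrite -[leRHS]ger0_norm ?mulr_ge0// -sqrtr_sqr ler_sqrt ?sqr_ge0// exprMn.
apply: (@le_trans _ _ (n%:R * `|x| ^+ 2)).
  rewrite mulr_natl -[X in _ *+ X]card_ord -sumr_const; apply: ler_sum => i _.
  by rewrite -real_normK ?num_real// ler_pXn2r ?nnegrE// rV_coord_le.
rewrite ler_wpM2r ?sqr_ge0// -natrX ler_nat; case: (n) => // k; exact: leq_pmulr.
Qed.

End RowNorms.

(** * Geometric convergence and the integral of an exponential *)

Section CauchyPicard.
Context {R : realType}.
Local Notation mu := (@lebesgue_measure R).
Local Notation Int a b g := (\int[mu]_(s in `[a, b]) g s).

(** With [e k] twice the [k]-th bound, [a k - e k] increases and [a k + e k]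
decreases, and the limit is the supremum of the former. *)
Lemma geometric_limit (a : nat -> R) (c : R) :
  (forall k, `|a k.+1 - a k| <= c * 2^-1 ^+ k) ->
  exists l, forall k, `|a k - l| <= 2 * c * 2^-1 ^+ k.
Proof.
move=> ac; pose e k : R := 2 * c * 2^-1 ^+ k.
have eS k : e k.+1 = e k - c * 2^-1 ^+ k by rewrite /e exprS; field.
have c0 : 0 <= c by have := le_trans (normr_ge0 _) (ac 0%N); rewrite expr0 mulr1.
have e0 k : 0 <= e k by rewrite /e !mulr_ge0// exprn_ge0.
have lo k j : a k - e k <= a (k + j)%N - e (k + j)%N.
  elim: j => [|j IH]; first by rewrite addn0.
  rewrite addnS (le_trans IH)// eS; have := ac (k + j)%N; rewrite ler_norml; lra.
have hi k j : a (k + j)%N + e (k + j)%N <= a k + e k.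
  elim: j => [|j IH]; first by rewrite addn0.
  rewrite addnS (le_trans _ IH)// eS; have := ac (k + j)%N; rewrite ler_norml; lra.
have lohi j k : a j - e j <= a k + e k.
  have := lo j k; have := hi k j; rewrite (addnC k j); have := e0 (j + k)%N; lra.
pose S := [set a j - e j | j in [set: nat]].
have ubS k : ubound S (a k + e k) by move=> _ [j _ <-].
exists (sup S) => k; rewrite ler_norml -/(e k).
have -> /= : a k - sup S <= e k.
  rewrite lerBlDr addrC -lerBlDr; apply: ub_le_sup; first by exists (a 0%N + e 0%N).
  by exists k.
have : sup S <= a k + e k by apply: ge_sup; [exists (a 0%N - e 0%N), 0%N|exact: ubS].
lra.
Qed.

Lemma le_geometric (a b c : R) : (forall k : nat, a <= b + c * 2^-1 ^+ k) -> a <= b.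
Proof.
move=> H; rewrite leNgt; apply/negP => ba.
have c0 : 0 < c by have := H 0%N; rewrite expr0; lra.
have [k _ Hk] : \forall k \near \oo, `|0 - (2^-1 : R) ^+ k| < (a - b) / c.
  have h : `|2^-1 : R| < 1 by rewrite ger0_norm//; lra.
  have /cvgrPdist_lt := cvg_expr h; apply; apply: divr_gt0 => //; lra.
have := Hk k (leqnn k); rewrite sub0r normrN ger0_norm ?exprn_ge0//.
rewrite ltr_pdivlMr// mulrC; have := H k; lra.
Qed.

Lemma Int_expR (k : R) : 0 < k -> forall t, 0 < t ->
  Int 0 t (fun s => expR (k * s)) = (expR (k * t) - 1) / k.
Proof.
move=> k0 t t0; pose F s := expR (k * s) / k.
have dF (s : R) : is_derive s 1 F (expR (k * s)).
  rewrite /F; apply: is_derive_eq.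
  by rewrite /GRing.scale/=; field; rewrite gt_eqF.
have cF : continuous F.
  by move=> s; apply: differentiable_continuous; apply/derivable1_diffP.
have cf : continuous (fun s => expR (k * s)).
  move=> s; apply: differentiable_continuous; apply/derivable1_diffP.
  exact: ex_derive.
rewrite /Rintegral (@continuous_FTC2 _ _ F)//.
- by rewrite -EFinB /= /F mulr0 expR0 mulrBl.
- exact: continuous_subspaceT.
- split; first by move=> s _; exact: ex_derive.
    exact/cvg_at_right_filter/cF.
  exact/cvg_at_left_filter/cF.
- by move=> s _; rewrite derive1E; exact: derive_val.
Qed.

End CauchyPicard.

(** * Functions dominated by a monotone function *)

Section Variation.
Context {R : realType}.

(** A witness of bounded variation on the unit interval that localizes: over adjacent
intervals the right-hand sides add up to a telescoping sum, so that partitions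
need not be mentioned. *)
Definition variation_bound (V : normedZmodType R) (v : R -> R) (w : R -> V) :=
  forall s t, 0 <= s -> s <= t -> t <= 1 -> `|w t - w s| <= v t - v s.

Lemma variation_bound_bounded (V : normedZmodType R) v (w : R -> V) :
  variation_bound v w ->
  forall t, 0 <= t <= 1 -> `|w t| <= `|w 0| + (v 1 - v 0).
Proof.
move=> vw t /andP[t0 t1]; rewrite -{1}(subrK (w 0) (w t)) addrC.
rewrite (le_trans (ler_normD _ _))// lerD2l (le_trans (vw _ _ _ t0 t1))//.
by have := le_trans (normr_ge0 _) (vw _ _ t0 t1 (lexx 1)); lra.
Qed.

(** Both [v] and [g + v] are nondecreasing on the unit interval, and [g] is their
difference.  Composing with the retraction [c] of the line onto that interval makes
them monotone everywhere. *)
Lemma variation_bound_measurable v (g : R -> R) :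
  variation_bound v g -> bounded_measurable g.
Proof.
move=> vg; split; last by exists (`|g 0| + (v 1 - v 0)); exact: variation_bound_bounded.
pose c t : R := Num.max 0 (Num.min t 1).
have c0 t : 0 <= c t by rewrite le_max lexx.
have c1 t : c t <= 1 by rewrite ge_max ler01 ge_min lexx orbT.
have cc s t : s <= t -> c s <= c t.
  move=> st; rewrite ge_max c0/= le_max; apply/orP; right.
  by rewrite le_min !ge_min lexx st /= !orbT.
have vc s t : s <= t -> `|g (c t) - g (c s)| <= v (c t) - v (c s).
  by move=> st; apply: vg => //; exact: cc.
have mv : measurable_fun (`[0, 1] : set R) (v \o c).
  apply: nondecreasing_measurable => // s t /vc H.
  by rewrite -subr_ge0; exact: le_trans (normr_ge0 _) H.
have mgv : measurable_fun (`[0, 1] : set R) (fun t => g (c t) + v (c t)).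
  apply: nondecreasing_measurable => // s t /vc; rewrite ler_norml; lra.
have := measurable_funB mgv mv.
apply: eq_measurable_fun => t; rewrite inE/= in_itv/= => /andP[t0 t1].
have -> : c t = t by rewrite /c min_l// max_r.
by rewrite addrK.
Qed.

Lemma coord_variation_bound k v (w : R -> 'rV[R]_k) i :
  variation_bound v w -> variation_bound v (fun t => w t 0 i).
Proof.
move=> vw s t s0 st t1.
by have := rV_coord_le (w t - w s) i; rewrite !mxE => /le_trans; apply; exact: vw.
Qed.

End Variation.

(** * Picard iteration under Caratheodory hypotheses *)

Section CaratheodoryODE.
Context {R : realType} (n : nat).
Local Notation mu := (@lebesgue_measure R).
Local Notation Int a b g := (\int[mu]_(s in `[a, b]) g s).
Implicit Types (x y : R -> 'rV[R]_n) (G : R -> 'rV[R]_n -> 'rV[R]_n).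

Definition lipschitz01 x := exists M, variation_bound (fun t => M * t) x.

(** Measurability is required along Lipschitz curves only, which is all that
Picard iteration meets. *)
Definition caratheodory_field (Lam C : R) (x0 : 'rV[R]_n) G :=
  [/\ forall t (a b : 'rV[R]_n), 0 <= t <= 1 -> `|G t a - G t b| <= Lam * `|a - b|,
      forall t, 0 <= t <= 1 -> `|G t x0| <= C &
      forall x, lipschitz01 x ->
        forall l, bounded_measurable (fun s => G s (x s) 0 l)].

Definition picard (x0 : 'rV[R]_n) G x (t : R) : 'rV[R]_n :=
  \row_l (x0 0 l + Int 0 t (fun s => G s (x s) 0 l)).

Variables (Lam C : R) (x0 : 'rV[R]_n).
Hypothesis Lam0 : 0 < Lam.

(** The exponential weight of Bielecki.  The factor 2 in the exponent makes
[Lam * Int 0 t weight] at most half of [weight t], so that the Picard operator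
halves distances in the weighted norm on the whole of the unit interval. *)
Definition weight t := expR (2 * Lam * t).

Lemma weight_ge1 t : 0 <= t -> 1 <= weight t.
Proof.
move=> t0; rewrite /weight -[leLHS]expR0 ler_expR.
by rewrite !mulr_ge0 ?(ltW Lam0).
Qed.

Lemma weight_le t : t <= 1 -> weight t <= weight 1.
Proof.
move=> t1; rewrite /weight ler_expR; apply: ler_wpM2l => //.
by rewrite mulr_ge0 ?(ltW Lam0).
Qed.

Lemma weight_measurable : bounded_measurable weight.
Proof.
apply: (@variation_bound_measurable _ weight) => s t s0 st t1.
rewrite ger0_norm// subr_ge0 /weight ler_expR; apply: ler_wpM2l => //.
by rewrite mulr_ge0 ?(ltW Lam0).
Qed.

Lemma Int_weight t : 0 <= t -> Lam * Int 0 t weight <= weight t / 2.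
Proof.
rewrite le_eqVlt => /predU1P[<-|t0].
  by rewrite Int_point mulr0 /weight divr_ge0// expR_ge0.
rewrite /weight Int_expR//; last exact: mulr_gt0.
have -> : Lam * ((expR (2 * Lam * t) - 1) / (2 * Lam)) = (expR (2 * Lam * t) - 1) / 2.
  by field; rewrite gt_eqF.
by lra.
Qed.

Lemma lipschitz01_cst (c : 'rV[R]_n) : lipschitz01 (cst c).
Proof. by exists 0 => s t _ _ _; rewrite subrr normr0 !mul0r subrr. Qed.

Lemma lipschitz01_dist_bounded x y : lipschitz01 x -> lipschitz01 y ->
  exists B, forall t, 0 <= t <= 1 -> `|x t - y t| <= B.
Proof.
move=> [M xM] [M' yM]; exists (`|x 0| + (M * 1 - M * 0) + (`|y 0| + (M' * 1 - M' * 0))).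
move=> t t01; rewrite (le_trans (ler_normB _ _))// lerD//.
  exact: (variation_bound_bounded xM).
exact: (variation_bound_bounded yM).
Qed.

Section OneField.
Variable G : R -> 'rV[R]_n -> 'rV[R]_n.
Hypothesis GH : caratheodory_field Lam C x0 G.

Let Glip := let: And3 h _ _ := GH in h.
Let Gx0 := let: And3 _ h _ := GH in h.
Let Gmeas := let: And3 _ _ h := GH in h.

Lemma field_bound_ge0 : 0 <= C.
Proof. by apply: le_trans (normr_ge0 _) (@Gx0 0 _); rewrite lexx ler01. Qed.

Lemma picard_contraction x y M : lipschitz01 x -> lipschitz01 y -> 0 <= M ->
  (forall t, 0 <= t <= 1 -> `|x t - y t| <= M * weight t) ->
  forall t, 0 <= t <= 1 ->
    `|picard x0 G x t - picard x0 G y t| <= M / 2 * weight t.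
Proof.
move=> lx ly M0 xy t /andP[t0 t1].
have bx := Gmeas lx; have by_ := Gmeas ly.
apply: rV_norm_le; first by rewrite !mulr_ge0// expR_ge0.
move=> l; rewrite !mxE opprD addrACA subrr add0r -IntB//.
have bd := bounded_measurableB (bx l) (by_ l).
have bW : bounded_measurable (fun s => (Lam * M) * weight s).
  exact: (bounded_measurableM (bounded_measurable_cst _) weight_measurable).
have dW s : 0 <= s < t -> `|G s (x s) 0 l - G s (y s) 0 l| <= (Lam * M) * weight s.
  move=> /andP[s0 st]; have s01 : 0 <= s <= 1 by rewrite s0/=; lra.
  have := rV_coord_le (G s (x s) - G s (y s)) l; rewrite !mxE => /le_trans; apply.
  by rewrite (le_trans (Glip _ _ s01))// -mulrA ler_pM2l// xy.
have -> : M / 2 * weight t = M * (weight t / 2) by lra.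
apply: le_trans (@Int_norm_le_Int _ (fun s => (Lam * M) * weight s) _ _ _ _ _ _ _ dW) _ => //.
rewrite IntZ//; last exact: weight_measurable.
by rewrite -mulrA mulrCA ler_wpM2l// Int_weight.
Qed.

(** The least [m] with [|x - y| <= m * weight] satisfies [m <= A + m / 2] by
contraction. *)
Lemma gronwall x y A : lipschitz01 x -> lipschitz01 y -> 0 <= A ->
  (forall t, 0 <= t <= 1 ->
     `|x t - y t| <= A + `|picard x0 G x t - picard x0 G y t|) ->
  forall t, 0 <= t <= 1 -> `|x t - y t| <= 2 * A * weight t.
Proof.
move=> lx ly A0 H.
have W0 t : 0 < weight t by exact: expR_gt0.
have [B xyB] := lipschitz01_dist_bounded lx ly.
pose S := [set `|x t - y t| / weight t | t in `[0, 1]].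
have supS : has_sup S.
  split; first by exists (`|x 0 - y 0| / weight 0), 0 => //=; rewrite in_itv/= lexx ler01.
  exists B => _ [t + <-]; rewrite /= in_itv/= => t01.
  rewrite ler_pdivrMr// (le_trans (xyB _ t01))//.
  rewrite ler_peMr ?weight_ge1//; last by case/andP: t01.
  exact: le_trans (normr_ge0 _) (xyB _ t01).
set m := sup S.
have xym t : 0 <= t <= 1 -> `|x t - y t| <= m * weight t.
  move=> t01; rewrite -ler_pdivrMr//; apply: ub_le_sup; first exact: supS.2.
  by exists t.
have m0 : 0 <= m.
  have := @xym 0; rewrite lexx ler01 => /(_ isT) /(le_trans (normr_ge0 _)).
  by rewrite pmulr_lge0.
have mA : m <= A + m / 2.
  apply: ge_sup; first exact: supS.1.
  move=> _ [t + <-]; rewrite /= in_itv/= => t01.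
  rewrite ler_pdivrMr// mulrDl (le_trans (H _ t01))// lerD//.
    by rewrite ler_peMr// weight_ge1//; case/andP: t01.
  exact: picard_contraction.
move=> t t01; rewrite (le_trans (xym _ t01))// ler_wpM2r//; first exact: ltW.
by lra.
Qed.

Lemma field_bound x t D : 0 <= t <= 1 -> `|x t - x0| <= D ->
  `|G t (x t)| <= C + Lam * D.
Proof.
move=> t01 xD; rewrite -{1}(subrK (G t x0) (G t (x t))) addrC.
rewrite (le_trans (ler_normD _ _))// lerD ?Gx0//.
by rewrite (le_trans (Glip _ _ t01))// ler_pM2l.
Qed.

Lemma picard_lip x B : lipschitz01 x ->
  (forall t, 0 <= t <= 1 -> `|G t (x t)| <= B) ->
  variation_bound (fun t => B * t) (picard x0 G x).
Proof.
move=> lx GB s t s0 st t1; rewrite -mulrBr.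
have B0 : 0 <= B by apply: le_trans (normr_ge0 _) (GB 0 _); rewrite lexx ler01.
apply: rV_norm_le; first by rewrite mulr_ge0// subr_ge0.
move=> l; rewrite !mxE opprD addrACA subrr add0r.
apply: (Int_lip (Gmeas lx l)) => // r r01.
exact: le_trans (rV_coord_le _ _) (GB _ r01).
Qed.

Lemma picard_cst t : 0 <= t <= 1 -> `|picard x0 G (cst x0) t - x0| <= C.
Proof.
move=> /andP[t0 t1]; apply: rV_norm_le; first exact: field_bound_ge0.
move=> l; rewrite !mxE addrAC subrr add0r.
rewrite (le_trans (@Int_norm_le R _ 0 t C _ _ _ _ _))//.
- exact: (Gmeas (lipschitz01_cst x0)).
- move=> s /andP[s0 st]; apply: le_trans (rV_coord_le _ _) (Gx0 _).
  by rewrite s0 (le_trans (ltW st)).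
- by rewrite subr0 ler_piMr// field_bound_ge0.
Qed.

(** A bound of the field along any solution, and so a Lipschitz constant of the
solution; it is the same for all fields with the same constants. *)
Definition speed := C + Lam * (2 * C * weight 1).

Lemma picard_stays x : lipschitz01 x ->
  (forall t, 0 <= t <= 1 -> `|x t - x0| <= 2 * C * weight t) ->
  forall t, 0 <= t <= 1 -> `|picard x0 G x t - x0| <= 2 * C * weight t.
Proof.
move=> lx xC t t01; have t0 : 0 <= t by case/andP: t01.
rewrite -(subrKA (picard x0 G (cst x0) t)) (le_trans (ler_normD _ _))//.
have C20 : 0 <= 2 * C by rewrite mulr_ge0// field_bound_ge0.
have := picard_contraction lx (lipschitz01_cst x0) C20 xC t01.
have := picard_cst t01.
have : C <= C * weight t by rewrite ler_peMr ?field_bound_ge0// weight_ge1.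
lra.
Qed.

Lemma picard_speed x : lipschitz01 x ->
  (forall t, 0 <= t <= 1 -> `|x t - x0| <= 2 * C * weight t) ->
  variation_bound (fun t => speed * t) (picard x0 G x).
Proof.
move=> lx xC; apply: picard_lip => // t t01; apply: field_bound => //.
rewrite (le_trans (xC _ t01))// ler_wpM2l ?mulr_ge0 ?field_bound_ge0//.
by apply: weight_le; case/andP: t01.
Qed.

(** The iterates from the constant [x0] converge at a geometric rate for the
weighted norm.  They all share the Lipschitz constant [speed], which therefore
passes to the limit. *)
Lemma picard_fixpoint : exists2 x, variation_bound (fun t => speed * t) x &
  forall t, 0 <= t <= 1 -> x t = picard x0 G x t.
Proof.
pose xk k := iter k (picard x0 G) (cst x0).
have C20 : 0 <= 2 * C by rewrite mulr_ge0// field_bound_ge0.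
have xkP k : lipschitz01 (xk k) /\
    (forall t, 0 <= t <= 1 -> `|xk k t - x0| <= 2 * C * weight t).
  elim: k => [|k [lk ck]].
    split; first exact: lipschitz01_cst.
    by move=> t /andP[t0 t1]; rewrite subrr normr0 mulr_ge0// expR_ge0.
  split; last exact: picard_stays.
  by exists speed; exact: picard_speed.
have xk_step k t : 0 <= t <= 1 -> `|xk k.+1 t - xk k t| <= C * 2^-1 ^+ k * weight t.
  elim: k t => [|k IH] t t01.
    rewrite expr0 mulr1 (le_trans (picard_cst t01))// ler_peMr ?field_bound_ge0// weight_ge1//.
    by case/andP: t01.
  have := picard_contraction (xkP k.+1).1 (xkP k).1 _ IH t01.
  rewrite exprSr mulrA; apply; rewrite mulr_ge0 ?field_bound_ge0// exprn_ge0//.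
have xk_lim t l : {a | 0 <= t <= 1 ->
    forall k, `|xk k t 0 l - a| <= 2 * (C * weight t) * 2^-1 ^+ k}.
  apply: cid; have [t01|nt01] := boolP (0 <= t <= 1); last by exists 0.
  have [|a Ha] := @geometric_limit R (fun k => xk k t 0 l) (C * weight t); last by exists a.
  move=> k; have := rV_coord_le (xk k.+1 t - xk k t) l; rewrite !mxE => /le_trans; apply.
  by rewrite mulrAC; exact: xk_step.
pose x t : 'rV[R]_n := \row_l sval (xk_lim t l).
have xkx k t : 0 <= t <= 1 -> `|xk k t - x t| <= 2 * C * 2^-1 ^+ k * weight t.
  move=> t01; apply: rV_norm_le.
    by rewrite !mulr_ge0 ?field_bound_ge0 ?exprn_ge0 ?expR_ge0.
  move=> l; rewrite !mxE; case: (xk_lim t l) => a /= /(_ t01 k).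
  by rewrite mulrA mulrAC.
have lx : variation_bound (fun t => speed * t) x.
  move=> s t s0 st t1; apply: (@le_geometric _ _ _ (4 * C * weight 1)) => k.
  have s01 : 0 <= s <= 1 by rewrite s0 (le_trans st).
  have t01 : 0 <= t <= 1 by rewrite (le_trans s0).
  have vk := @picard_speed _ (xkP k).1 (xkP k).2 s t s0 st t1.
  have xs := xkx k.+1 s s01; have xt := xkx k.+1 t t01.
  have Hw r : 0 <= r <= 1 -> 2 * C * 2^-1 ^+ k.+1 * weight r <= 2 * C * weight 1 * 2^-1 ^+ k.
    move=> /andP[r0 r1]; rewrite -mulrA [leRHS]mulrAC -[leRHS]mulrA ler_wpM2l//.
    rewrite ler_pM ?exprn_ge0 ?expR_ge0 ?weight_le//.
    by rewrite exprS ger_pMl ?exprn_gt0//; lra.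
  have := Hw _ s01; have := Hw _ t01.
  have -> : x t - x s = (xk k.+1 t - xk k.+1 s) - (xk k.+1 t - x t) + (xk k.+1 s - x s).
    by apply/rowP => l; rewrite !mxE; ring.
  have := ler_normD ((xk k.+1 t - xk k.+1 s) - (xk k.+1 t - x t)) (xk k.+1 s - x s).
  have := ler_normB (xk k.+1 t - xk k.+1 s) (xk k.+1 t - x t).
  by move: vk xs xt => /=; lra.
exists x => // t t01; apply/eqP; rewrite -subr_eq0 -normr_le0.
have l01 : lipschitz01 x by exists speed.
apply: (@le_geometric _ _ _ (2 * C * weight t)) => k; rewrite add0r.
have xk1 := xkx k.+1 t t01.
have Ck : 0 <= 2 * C * 2^-1 ^+ k by rewrite mulr_ge0// exprn_ge0.
have := picard_contraction (xkP k).1 l01 Ck (xkx k) t01.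
have -> : x t - picard x0 G x t =
  (picard x0 G (xk k) t - picard x0 G x t) - (xk k.+1 t - x t).
  by apply/rowP => l; rewrite !mxE; ring.
have := ler_normB (picard x0 G (xk k) t - picard x0 G x t) (xk k.+1 t - x t).
move: xk1; rewrite exprS; lra.
Qed.

(** A solution is compared by [gronwall] with the constant curve [x0], which
misses the integral equation by at most [C]. *)
Lemma solution_speed x : lipschitz01 x ->
  (forall t, 0 <= t <= 1 -> x t = picard x0 G x t) ->
  (forall t, 0 <= t <= 1 -> `|x t - x0| <= 2 * C * weight t) /\
  variation_bound (fun t => speed * t) x.
Proof.
move=> lx xE.
have xC : forall t, 0 <= t <= 1 -> `|x t - x0| <= 2 * C * weight t.
  apply: (@gronwall x (cst x0) C lx (lipschitz01_cst x0) field_bound_ge0) => t t01.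
  rewrite xE//= -(subrKA (picard x0 G (cst x0) t)) (le_trans (ler_normD _ _))//.
  by rewrite addrC lerD2r picard_cst.
split => // s t s0 st t1; rewrite !xE; [|lra..].
exact: picard_speed.
Qed.

End OneField.
End CaratheodoryODE.

(** * Trajectories as fixed points of the Picard operator *)

Section Trajectories.
Context {R : realType} (n m q : nat).
Local Notation mu := (@lebesgue_measure R).
Local Notation Int a b g := (\int[mu]_(s in `[a, b]) g s).

Lemma ae_forall_ord k (P : 'I_k -> R -> Prop) :
  (forall l, {ae mu, forall t : R, P l t}) ->
  {ae mu, forall t : R, forall l, P l t}.
Proof. by move=> H; exact: filter_forall. Qed.

Lemma is_derive_coord (x : R -> 'rV[R]_n) (t : R) (v : 'rV[R]_n) :
  is_derive t 1 x v <-> forall l, is_derive t 1 (fun s => x s 0 l) (v 0 l).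
Proof.
split=> [[dx <-] l|H].
  apply: DeriveDef; first by move/derivable_mxP : dx; apply.
  by rewrite derive_mx// mxE.
have dx : derivable x t 1.
  by apply/derivable_mxP => i l; rewrite ord1; case: (H l).
apply: DeriveDef => //; rewrite derive_mx//; apply/rowP => l; rewrite mxE.
by case: (H l).
Qed.

Lemma lipschitz01_abs_continuous (x : R -> 'rV[R]_n) :
  lipschitz01 x -> abs_continuous x.
Proof.
move=> [M xM] e e0.
have M0 : 0 <= M.
  have := le_trans (normr_ge0 _) (xM 0 1 (lexx 0) ler01 (lexx 1)).
  by rewrite mulr1 mulr0 subr0.
(* the function [n * M * t] dominates the increments of [x], in Euclidean norm *)
have acy : scalar_abs_continuous (fun t => n%:R * M * t).
  apply: (@scalar_abs_continuous_lip _ _ (n%:R * M)) => s t _ st _.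
  by rewrite -mulrBr ger0_norm// mulr_ge0// ?mulr_ge0// subr_ge0.
have [d d0 Hd] := acy _ e0; exists d => // l a b ab dis sd.
apply: le_lt_trans (Hd l a b ab dis sd); apply: ler_sum => i _.
have [a0 aib b1] := ab i.
rewrite (le_trans (norm2_le_norm _))//.
have := xM _ _ a0 aib b1; rewrite -!mulrBr => H.
rewrite ger0_norm; last by rewrite !mulr_ge0// subr_ge0.
by rewrite -mulrA ler_wpM2l.
Qed.

Lemma abs_continuous_coord (x : R -> 'rV[R]_n) l :
  abs_continuous x -> scalar_abs_continuous (fun t => x t 0 l).
Proof.
move=> acx e e0; have [d d0 Hd] := acx _ e0; exists d => // k a b ab dis sd.
apply: le_lt_trans (Hd k a b ab dis sd); apply: ler_sum => i _.
have := rV_coord_le (x (b i) - x (a i)) l; rewrite !mxE => /le_trans; apply.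
exact: norm_le_norm2.
Qed.

(** Absolute continuity applied to a single interval bounds [x] near each point;
bounds on adjacent intervals combine. *)
Lemma abs_continuous_bounded (x : R -> 'rV[R]_n) (c : 'rV[R]_n) :
  abs_continuous x -> exists D, forall t, 0 <= t <= 1 -> `|x t - c| <= D.
Proof.
move=> acx.
apply: (@interval_induction R (fun s u => exists D, forall t, s <= t <= u -> `|x t - c| <= D))
  => //.
  move=> s t u _ st tu _ [D HD] [E HE]; exists (Num.max D E) => r /andP[sr ru].
  have [rt|tr] := leP r t; rewrite le_max; first by rewrite HD// sr.
  by rewrite HE ?orbT// ru ltW.
move=> t /andP[t0 t1]; have [d d0 Hd] := acx 1 ltr01.
exists d => // s u s0 st tu u1 ts ut; exists (`|x t - c| + 1) => r /andP[sr ru].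
rewrite -(subrKA (x t)) addrC (le_trans (ler_normD _ _))// lerD2l.
have [rt|tr] := leP r t.
  have := Hd 1%N (fun=> r) (fun=> t); rewrite !big_ord1 -normrN opprB.
  move=> H; apply: le_trans (norm_le_norm2 _) (ltW (H _ _ _)).
  - by move=> _; split => //; lra.
  - by move=> i j; rewrite !ord1.
  - by lra.
have := Hd 1%N (fun=> t) (fun=> r); rewrite !big_ord1.
move=> H; apply: le_trans (norm_le_norm2 _) (ltW (H _ _ _)).
- by move=> _; split => //; lra.
- by move=> i j; rewrite !ord1.
- by lra.
Qed.

Variables (f : 'I_q -> R -> 'rV[R]_n -> 'rV[R]_m -> 'rV[R]_n) (x0 : 'rV[R]_n).
Variables (xi : (R -> 'rV[R]_m) * (R -> 'rV[R]_q)) (Lam C : R).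
Hypothesis Lam0 : 0 < Lam.
Let G t x := vector_field f t x (xi.1 t) (xi.2 t).
Hypothesis GH : caratheodory_field Lam C x0 G.

(** The integral equation holds on the unit interval only, so differentiation needs an
interior point. *)
Lemma picard_fixpoint_trajectory x : lipschitz01 x ->
  (forall t, 0 <= t <= 1 -> x t = picard x0 G x t) -> is_trajectory f x0 xi x.
Proof.
move=> lx xE; have [_ _ Gm] := GH; split; last 1 first.
- have H : {ae mu, forall t : R, forall l, 0 <= t <= 1 ->
      is_derive t 1 (fun s => Int 0 s (fun r => G r (x r) 0 l)) (G t (x t) 0 l)}.
    by apply: ae_forall_ord => l; exact: ae_is_derive_Int (Gm _ lx l).
  have ae01 := ae_and2 (fun t a b => conj a b) (ae_neq (0 : R)) (ae_neq (1 : R)).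
  apply: ae_and2 ae01 H => t /= [tn0 tn1] H t01; apply/is_derive_coord => l.
  have := H l t01 => dI.
  have /andP[t0 t1] : 0 < t < 1.
    by rewrite !lt_neqAle eq_sym; move/eqP: tn0 => ->; move/eqP: tn1 => ->.
  have dJ : is_derive t 1 (cst (x0 0 l) + (fun s => Int 0 s (fun r => G r (x r) 0 l)))
     (G t (x t) 0 l).
    by apply: is_derive_eq; rewrite add0r.
  apply: near_eq_is_derive dJ.
  near=> s; rewrite xE ?mxE//; apply/andP; split.
    by near: s; exact: lt_le_nbhsr.
  by near: s; exact: lt_le_nbhsl.
- rewrite xE ?lexx ?ler01//; apply/rowP => l; rewrite !mxE.
  by rewrite Int_point addr0.
- exact: lipschitz01_abs_continuous.
Unshelve. all: by end_near. Qed.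

(** A trajectory is bounded, so the field is bounded along it, and the bound on
the derivative makes it Lipschitz.  Only then is the field known to be
measurable along it, as the fundamental theorem requires. *)
Lemma trajectory_picard_fixpoint x : is_trajectory f x0 xi x ->
  lipschitz01 x /\ (forall t, 0 <= t <= 1 -> x t = picard x0 G x t).
Proof.
move=> [xx0 acx dx]; have [_ _ Gm] := GH.
have [D xD] := abs_continuous_bounded x0 acx.
pose B := C + Lam * D.
have GB t : 0 <= t <= 1 -> `|G t (x t)| <= B.
  by move=> t01; exact: (field_bound Lam0 GH t01 (xD _ t01)).
have B0 : 0 <= B by apply: le_trans (normr_ge0 _) (GB 0 _); rewrite lexx ler01.
have dxl l : {ae mu, forall t : R, 0 <= t <= 1 ->
    is_derive t 1 (fun s => x s 0 l) (G t (x t) 0 l)}.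
  apply: (ae_and2 _ dx dx) => t dxt _ t01.
  exact: ((is_derive_coord _ _ _).1 (dxt t01) l).
have lx : lipschitz01 x.
  exists B => s t s0 st t1; rewrite -mulrBr.
  apply: rV_norm_le; first by rewrite mulr_ge0// subr_ge0.
  move=> l; have := abs_continuous_bounded_derive_lip B0 (abs_continuous_coord l acx).
  rewrite !mxE; apply => //.
  apply: ae_and2 (dxl l) (dxl l) => r dr _ r01; exists (G r (x r) 0 l).
    exact: dr.
  exact: le_trans (rV_coord_le _ _) (GB _ r01).
split => // t t01; apply/rowP => l; rewrite !mxE -xx0.
exact: (abs_continuous_Int (Gm _ lx l) (abs_continuous_coord l acx) (dxl l)).
Qed.

Lemma trajectory_exists : exists x, is_trajectory f x0 xi x.
Proof.
have [x vx xE] := picard_fixpoint Lam0 GH.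
by exists x; apply: picard_fixpoint_trajectory => //; exists (speed Lam C).
Qed.

Lemma phi_trajectory : is_trajectory f x0 xi (fun t => phi f x0 t xi).
Proof.
have [x hx] := trajectory_exists.
exact: (@xgetI _ _ [set x : R -> 'rV[R]_n | is_trajectory f x0 xi x] x hx).
Qed.

End Trajectories.

(** Both controls have the same trajectories, whence [phi], a choice among them,
is the same. *)
Lemma phi_eq_ae {R : realType} n m q
  (f : 'I_q -> R -> 'rV[R]_n -> 'rV[R]_m -> 'rV[R]_n) (x0 : 'rV[R]_n)
  (xi xi' : (R -> 'rV[R]_m) * (R -> 'rV[R]_q)) t :
  (forall s, 0 <= s < 1 -> xi.1 s = xi'.1 s /\ xi.2 s = xi'.2 s) ->
  phi f x0 t xi = phi f x0 t xi'.
Proof.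
move=> E; rewrite /phi.
suff -> : [set x | is_trajectory f x0 xi x] = [set x | is_trajectory f x0 xi' x] by [].
suff H (a b : (R -> 'rV[R]_m) * (R -> 'rV[R]_q)) :
    (forall s, 0 <= s < 1 -> a.1 s = b.1 s /\ a.2 s = b.2 s) ->
    [set x | is_trajectory f x0 a x] `<=` [set x | is_trajectory f x0 b x].
  apply/seteqP; split; apply: H => // s /E[-> ->] //.
move=> ab x [xx0 acx dx]; split => //.
apply: ae_and2 dx (ae_neq 1) => s ds s1 s01.
have [] := ab s; last by move=> <- <-; exact: ds.
by case/andP: s01 => -> /=; rewrite lt_neqAle => ->; rewrite andbT; exact/eqP.
Qed.

(** * Stability of trajectories with respect to the control *)

Section AdmissibleControls.
Context {R : realType} (n m q : nat).
Local Notation mu := (@lebesgue_measure R).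
Local Notation Int a b g := (\int[mu]_(s in `[a, b]) g s).
Variables (U : set 'rV[R]_m) (x0 : 'rV[R]_n).
Variable f : 'I_q -> R -> 'rV[R]_n -> 'rV[R]_m -> 'rV[R]_n.

Definition sup_lipschitz (V : set 'rV[R]_m) (Lam : R) :=
  forall i s t x y u v, 0 <= s <= 1 -> 0 <= t <= 1 -> V u -> V v ->
    `|f i s x u - f i t y v| <= Lam * (`|s - t| + `|x - y| + `|u - v|).

Lemma lipschitz_data_sup (L : R) : 0 < L ->
  (forall i, lipschitz_data (@norm2 R n) U L (f i)) ->
  sup_lipschitz U (L * (n + m).+1%:R).
Proof.
move=> L0 fL i s t x y u v s01 t01 Uu Uv.
rewrite (le_trans (norm_le_norm2 _))// (le_trans (fL i s t x y u v s01 t01 Uu Uv))//.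
rewrite -mulrA ler_pM2l// !mulrDr.
have le1 (k : nat) (z : R) : (k <= (n + m).+1)%N -> 0 <= z -> k%:R * z <= (n + m).+1%:R * z.
  by move=> kn z0; rewrite ler_wpM2r// ler_nat.
rewrite !lerD//.
- by rewrite -[leLHS]mul1r (le1 1%N).
- by rewrite (le_trans (norm2_le_norm _))// le1// ltnW// ltnS leq_addr.
- by rewrite (le_trans (norm2_le_norm _))// le1// ltnW// ltnS leq_addl.
Qed.

(** Differentiability in the control gives continuity at every point, also at the
points of the closure that are not in [U]. *)
Lemma sup_lipschitz_closure Lam : 0 < Lam ->
  (forall i t x u, differentiable (fun v => f i t x v) u) ->
  sup_lipschitz U Lam -> sup_lipschitz (closure U) Lam.
Proof.
move=> Lam0 fd fU i s t x y u v s01 t01 cu cv.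
have near_closure r z w (e : R) : 0 < e -> closure U w ->
    exists w', [/\ U w', `|w - w'| < e & `|f i r z w - f i r z w'| < e].
  move=> e0 cw.
  have /cvgrPdist_lt fc := differentiable_continuous (fd i r z w).
  have [w' [Uw' [w1 w2]]] := cw _ (filterI (nbhsx_ballx w _ e0) (fc _ e0)).
  exists w'; split => //; by move: w1; rewrite -ball_normE.
apply/ler_addgt0Pl => e e0.
(* moving both [u] and [v] by [e1] changes the two sides by [2 * e1] and
   [Lam * 2 * e1] in total *)
pose e1 := e / (2 + 2 * Lam).
have e10 : 0 < e1 by rewrite divr_gt0// addr_gt0// mulr_gt0.
have eE : e = 2 * e1 + Lam * (2 * e1).
  by rewrite /e1; field; rewrite gt_eqF// addr_gt0// mulr_gt0.
have [u' [Uu' uu' fu']] := near_closure s x u _ e10 cu.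
have [v' [Uv' vv' fv']] := near_closure t y v _ e10 cv.
have H := fU i s t x y u' v' s01 t01 Uu' Uv'.
have H1 : `|f i s x u - f i t y v| <=
    e1 + `|f i s x u' - f i t y v'| + e1.
  have -> : f i s x u - f i t y v = (f i s x u - f i s x u') +
     (f i s x u' - f i t y v') - (f i t y v - f i t y v').
    by apply/rowP => l; rewrite !mxE; ring.
  rewrite (le_trans (ler_normB _ _))// lerD ?(ltW fv')//.
  by rewrite (le_trans (ler_normD _ _))// lerD2r ltW.
have H2 : `|u' - v'| <= e1 + `|u - v| + e1.
  have -> : u' - v' = - (u - u') + (u - v) + (v - v').
    by apply/rowP => l; rewrite !mxE; ring.
  rewrite (le_trans (ler_normD _ _))// lerD ?(ltW vv')//.
  by rewrite (le_trans (ler_normD _ _))// lerD2r normrN ltW.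
rewrite (le_trans H1)// eE.
have : Lam * (`|s - t| + `|x - y| + `|u' - v'|) <=
    Lam * (`|s - t| + `|x - y| + (e1 + `|u - v| + e1)) by rewrite ler_pM2l// lerD2l.
move: H; rewrite !mulrDr; lra.
Qed.

Lemma bounded_field_closure Lam : 0 < Lam -> [bounded u | u in U] ->
  sup_lipschitz (closure U) Lam ->
  exists2 C0, 0 <= C0 & forall i t u, 0 <= t <= 1 -> closure U u -> `|f i t x0 u| <= C0.
Proof.
move=> Lam0 bU fU; have [[u0 Uu0]|nU] := pselect (U !=set0); last first.
  exists 0 => // i t u _ /(_ setT filterT) [w [Uw _]].
  by exfalso; apply: nU; exists w.
have [M [_ HM]] := bU; have {}HM := HM (M + 1) (ltr_pwDr ltr01 (lexx _)).
pose B := M + 1.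
have cB u : closure U u -> `|u| <= B + 1.
  move=> cu; have [w [Uw]] := cu _ (nbhsx_ballx u _ ltr01); rewrite -ball_normE/= => uw.
  rewrite -(subrK w u) addrC (le_trans (ler_normD _ _))// lerD ?(ltW uw)//.
  exact: HM.
have B0 : 0 <= B + 1 := le_trans (normr_ge0 _) (cB _ (subset_closure Uu0)).
exists (\sum_i `|f i 0 x0 u0| + Lam * (1 + 2 * (B + 1))).
  by rewrite addr_ge0 ?sumr_ge0// mulr_ge0 ?(ltW Lam0)// addr_ge0// mulr_ge0.
move=> i t u t01 cu; rewrite -(subrK (f i 0 x0 u0) (f i t x0 u)) addrC.
rewrite (le_trans (ler_normD _ _))// lerD//.
  by rewrite (bigD1 i)//= lerDl sumr_ge0.
rewrite (le_trans (fU i t 0 x0 x0 u u0 t01 _ cu (subset_closure Uu0)))//.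
  by rewrite lexx ler01.
rewrite ler_pM2l// subrr normr0 addr0 lerD//.
  by case/andP: t01 => t0 t1; rewrite subr0 ger0_norm.
rewrite (le_trans (ler_normB _ _))// mulrDl mul1r lerD// cB//.
exact: subset_closure.
Qed.

(** Values are taken in the closure of [U], where the averages of [U]-valued
controls lie.  For the switching component only measurability and the range
are kept: a bound of its variation uniform in [N] is not available for the
pulses. *)
Definition admissible (v : R -> R) (u : R -> 'rV[R]_m) (d : R -> 'rV[R]_q) :=
  [/\ forall t, 0 <= t <= 1 -> closure U (u t),
      variation_bound v u,
      forall i, bounded_measurable (fun t => d t 0 i) &
      forall t i, 0 <= t <= 1 -> 0 <= d t 0 i <= 1].

Section FixedConstants.
Variables (Lam0 C0 : R).
Hypotheses (Lam0_gt0 : 0 < Lam0) (C0_ge0 : 0 <= C0).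
Hypothesis fU : sup_lipschitz (closure U) Lam0.
Hypothesis fC : forall i t u, 0 <= t <= 1 -> closure U u -> `|f i t x0 u| <= C0.

(** This is the function against which the switching error is integrated; its
variation involves the speed [M] of the curve and the variation of the
control. *)
Lemma field_along_variation v u d M x i l : admissible v u d ->
  variation_bound (fun t => M * t) x ->
  variation_bound (fun t => Lam0 * (t + M * t + v t))
    (fun s => f i s (x s) (u s) 0 l).
Proof.
move=> [cu vu _ _] vx s t s0 st t1.
have s01 : 0 <= s <= 1 by rewrite s0 (le_trans st).
have t01 : 0 <= t <= 1 by rewrite t1 (le_trans s0).
have := rV_coord_le (f i t (x t) (u t) - f i s (x s) (u s)) l; rewrite !mxE => /le_trans; apply.
rewrite (le_trans (fU _ _ _ t01 s01 (cu _ t01) (cu _ s01)))// -mulrBr ler_pM2l//.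
have := vu _ _ s0 st t1; have := vx _ _ s0 st t1 => /=.
rewrite (@ger0_norm _ (t - s)) ?subr_ge0//; lra.
Qed.

Lemma admissible_caratheodory v u d : admissible v u d ->
  caratheodory_field (q%:R * Lam0) (q%:R * C0) x0 (fun t x => vector_field f t x (u t) (d t)).
Proof.
move=> ad; have [cu vu dm d01] := ad.
have d1 t i : 0 <= t <= 1 -> `|d t 0 i| <= 1.
  by move=> /(d01 _ i) /andP[d0 d1]; rewrite ger0_norm.
split.
- move=> t x y t01; rewrite /vector_field -sumrB.
  rewrite (le_trans (ler_norm_sum _ _ _))//.
  rewrite -mulrA mulr_natl -[X in _ *+ X]card_ord -sumr_const; apply: ler_sum => i _.
  rewrite -scalerBr normrZ (le_trans (ler_wpM2r _ (d1 t i t01)))// mul1r.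
  rewrite (le_trans (fU i x y t01 t01 (cu _ t01) (cu _ t01)))//.
  by rewrite !subrr !normr0 add0r addr0.
- move=> t t01; rewrite /vector_field (le_trans (ler_norm_sum _ _ _))//.
  rewrite mulr_natl -[X in _ *+ X]card_ord -sumr_const; apply: ler_sum => i _.
  by rewrite normrZ (le_trans (ler_wpM2r _ (d1 t i t01)))// mul1r fC//; exact: cu.
- move=> x [M vx] l.
  apply: (@eq_bounded_measurable _ (fun s => \sum_(i < q) d s 0 i * f i s (x s) (u s) 0 l)).
    by move=> s _; rewrite /vector_field summxE; apply: eq_bigr => i _; rewrite mxE.
  apply: bounded_measurable_sum => i; apply: bounded_measurableM; first exact: dm.
  exact: variation_bound_measurable (field_along_variation i l ad vx).
Qed.

Let Lam := q%:R * Lam0.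
Let C := q%:R * C0.

(** The integrals of the two fields along the curve [x] are compared first: the
change of [u] is measured in [L^1] by [eta], that of [d] weakly by [E].  Then
[gronwall] applies to the field of the second control. *)
Lemma stability v u d v' u' d' x x' A eta E : (0 < q)%N ->
  admissible v u d -> admissible v' u' d' ->
  let G := fun t x => vector_field f t x (u t) (d t) in
  let G' := fun t x => vector_field f t x (u' t) (d' t) in
  lipschitz01 x -> lipschitz01 x' ->
  (forall t, 0 <= t <= 1 -> x t = picard x0 G x t) ->
  (forall t, 0 <= t <= 1 -> x' t = picard x0 G' x' t) ->
  (forall k, Int 0 1 (fun s => `|u' s 0 k - u s 0 k|) <= eta) ->
  (forall i l t, 0 <= t <= 1 ->
    `|Int 0 t (fun s => (d' s 0 i - d s 0 i) * f i s (x s) (u s) 0 l)| <= E) ->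
  A = q%:R * (Lam0 * (m%:R * eta) + E) -> 0 <= A ->
  forall t, 0 <= t <= 1 -> `|x' t - x t| <= 2 * A * weight Lam t.
Proof.
move=> q0 ad ad' G G' lx lx' xE xE' Heta HE AE A0.
have [cu vu dm d01] := ad; have [cu' vu' dm' d01'] := ad'.
have LamP : 0 < Lam by rewrite mulr_gt0// ltr0n.
have GH := admissible_caratheodory ad; have GH' := admissible_caratheodory ad'.
apply: (gronwall LamP GH' lx' lx A0) => t t01.
have [M vx] := lx; have /andP[t0 t1] := t01.
rewrite xE' // {1}(xE t t01) -(subrKA (picard x0 G' x t)) addrC.
rewrite (le_trans (ler_normD _ _))// lerD2r.
apply: rV_norm_le => // l; rewrite !mxE opprD addrACA subrr add0r.
have [_ _ Gm] := GH; have [_ _ Gm'] := GH'.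
rewrite -IntB//; [|exact: Gm'|exact: Gm].
have mf i := variation_bound_measurable (field_along_variation i l ad vx).
have vx' : variation_bound (fun t => M * t) x := vx.
have mf' i := variation_bound_measurable (field_along_variation i l ad' vx').
have mu_ k : bounded_measurable (fun s => `|u' s 0 k - u s 0 k|).
  apply/bounded_measurable_norm/bounded_measurableB.
    exact: variation_bound_measurable (coord_variation_bound k vu').
  exact: variation_bound_measurable (coord_variation_bound k vu).
(* [g1] accounts for the change of [u], [g2] for the change of [d] *)
pose g1 i s := d' s 0 i * (f i s (x s) (u' s) 0 l - f i s (x s) (u s) 0 l).
pose g2 i s := (d' s 0 i - d s 0 i) * f i s (x s) (u s) 0 l.
have mg1 i : bounded_measurable (g1 i).
  by apply: bounded_measurableM => //; exact: bounded_measurableB.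
have mg2 i : bounded_measurable (g2 i).
  by apply: bounded_measurableM => //; exact: bounded_measurableB.
rewrite (@eq_Int _ _ (fun s => \sum_i (g1 i s + g2 i s)) 0 t)//; first last.
- move=> s _; rewrite /G /G' /vector_field !summxE -sumrB; apply: eq_bigr => i _.
  by rewrite !mxE /g1 /g2; ring.
- by apply: bounded_measurable_sum => i; exact: bounded_measurableD.
- by apply: bounded_measurableB; [exact: Gm'|exact: Gm].
rewrite Int_sum//; last by move=> i; exact: bounded_measurableD.
rewrite (le_trans (ler_norm_sum _ _ _))// AE mulr_natl -[X in _ *+ X]card_ord -sumr_const.
apply: ler_sum => i _; rewrite IntD// (le_trans (ler_normD _ _))// lerD//; last exact: HE.
pose h s := Lam0 * \sum_k `|u' s 0 k - u s 0 k|.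
have mh : bounded_measurable h.
  apply: bounded_measurableM; first exact: bounded_measurable_cst.
  exact: bounded_measurable_sum.
have gh s : 0 <= s < t -> `|g1 i s| <= h s.
  move=> /andP[s0 st]; have s01 : 0 <= s <= 1 by rewrite s0/= (le_trans (ltW st)).
  have /andP[d0 d1] := d01' s i s01.
  rewrite /g1 normrM (ger0_norm d0) (le_trans (ler_wpM2r _ d1))// mul1r.
  have := rV_coord_le (f i s (x s) (u' s) - f i s (x s) (u s)) l; rewrite !mxE => /le_trans; apply.
  rewrite (le_trans (fU _ _ _ s01 s01 (cu' _ s01) (cu _ s01)))//.
  rewrite !subrr !normr0 !add0r ler_pM2l//; apply: rV_norm_le; first exact: sumr_ge0.
  by move=> k; rewrite !mxE (bigD1 k)//= lerDl sumr_ge0.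
apply: le_trans (@Int_norm_le_Int _ h _ _ _ _ _ _ _ gh) _ => //.
rewrite IntZ//; last exact: bounded_measurable_sum.
rewrite ler_pM2l// Int_sum// mulr_natl -[X in _ *+ X]card_ord -sumr_const.
apply: ler_sum => k _; apply: le_trans (Heta k).
rewrite (@Int_split _ _ 0 t 1)// lerDl.
by apply: Rintegral_ge0.
Qed.

End FixedConstants.
End AdmissibleControls.

(** * Averages and oscillation estimates on grids *)

Section Grids.
Context {R : realType}.
Local Notation mu := (@lebesgue_measure R).
Local Notation Int a b g := (\int[mu]_(s in `[a, b]) g s).

Lemma grid_le (r : nat -> R) : (forall k, r k <= r k.+1) ->
  forall j k, (j <= k)%N -> r j <= r k.
Proof. by move=> rS; apply: (@homo_leq _ r <=%R) => //; exact: le_trans. Qed.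

Lemma Int_grid (r : nat -> R) g K : (forall k, r k <= r k.+1) -> 0 <= r 0%N ->
  r K <= 1 -> bounded_measurable g ->
  Int (r 0%N) (r K) g = \sum_(0 <= k < K) Int (r k) (r k.+1) g.
Proof.
move=> rS r0 rK bg; elim: K rK => [_|K IH rK]; first by rewrite big_geq// Int_point.
rewrite big_nat_recr//= -IH; last exact: le_trans rK.
by apply: Int_split => //; exact: grid_le.
Qed.

Lemma Int_grid_le (r : nat -> R) g (w : R -> R) K : (forall k, r k <= r k.+1) ->
  0 <= r 0%N -> r K <= 1 -> bounded_measurable g ->
  (forall k, (k < K)%N -> `|Int (r k) (r k.+1) g| <= w (r k.+1) - w (r k)) ->
  `|Int (r 0%N) (r K) g| <= w (r K) - w (r 0%N).
Proof.
move=> rS r0 rK bg gw; rewrite Int_grid//.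
rewrite -(telescope_sumr (fun k => w (r k)) (leq0n K)).
rewrite (le_trans (ler_norm_sum _ _ _))// !big_nat.
by apply: ler_sum => k /andP[_ kK]; exact: gw.
Qed.

Definition average (g : R -> R) a b := (b - a)^-1 * Int a b g.

Lemma averageE g a b : a < b -> Int a b g = (b - a) * average g a b.
Proof. by move=> ab; rewrite /average mulVKf// subr_eq0 gt_eqF. Qed.

Lemma average_dist g a b c e : 0 <= a -> a < b -> b <= 1 -> bounded_measurable g ->
  (forall s, a <= s < b -> `|g s - c| <= e) -> `|average g a b - c| <= e.
Proof.
move=> a0 ab b1 bg gc; have ba0 : 0 < b - a by rewrite subr_gt0.
rewrite -(ler_pM2l ba0) -{1}(gtr0_norm ba0) -normrM mulrBr -averageE//.
rewrite (mulrC _ c) -(Int_cst c (ltW ab)) -IntB//; last exact: bounded_measurable_cst.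
rewrite mulrC; apply: Int_norm_le => //; first exact: ltW.
exact: (bounded_measurableB bg (bounded_measurable_cst c)).
Qed.

(** The mean of [K + 2] points is a convex combination of the mean of the first
[K + 1] of them and the last one. *)
Lemma convex_mean m (U : set 'rV[R]_m) (y : nat -> 'rV[R]_m) K :
  convex_set (U : set (convex_lmodType 'rV[R]_m)) ->
  (forall k, (k <= K)%N -> U (y k)) ->
  U (K.+1%:R^-1 *: \sum_(0 <= k < K.+1) y k).
Proof.
move=> cU; elim: K => [|K IH] Uy.
  by rewrite big_nat1 invr1 scale1r; exact: Uy.
rewrite big_nat_recr//=.
have p0 : 0 <= (K.+1%:R / K.+2%:R : R) by rewrite divr_ge0.
have p1 : (K.+1%:R / K.+2%:R : R) <= 1 by rewrite ler_pdivrMr// mul1r ler_nat.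
have UK : U (K.+1%:R^-1 *: \sum_(0 <= k < K.+1) y k) by apply: IH => k kK; apply: Uy; exact: leqW.
have := cU _ _ (Itv01 p0 p1) (mem_set UK) (mem_set (Uy K.+1 (leqnn _))).
rewrite inE => H.
have -> : K.+2%:R^-1 *: (\sum_(0 <= k < K.+1) y k + y K.+1) =
    (K.+1%:R / K.+2%:R) *: (K.+1%:R^-1 *: \sum_(0 <= k < K.+1) y k) +
    (1 - K.+1%:R / K.+2%:R) *: y K.+1.
  rewrite scalerDr scalerA; congr (_ *: _ + _ *: _).
    by rewrite mulrAC divff ?mul1r// pnatr_eq0.
  have : K.+2%:R != 0 :> R by rewrite pnatr_eq0.
  by rewrite -(natr1 K.+1) => K0; field.
exact: H.
Qed.

(** The Riemann sums on uniform grids are means of values of [u], hence in [U],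
and converge to the average since [u] has bounded variation. *)
Lemma average_closure m (U : set 'rV[R]_m) v (u : R -> 'rV[R]_m) a b :
  convex_set (U : set (convex_lmodType 'rV[R]_m)) ->
  variation_bound v u -> 0 <= a -> a < b -> b <= 1 ->
  (forall t, a <= t <= b -> U (u t)) ->
  closure U (\row_l average (fun s => u s 0 l) a b).
Proof.
move=> cU vu a0 ab b1 Uu B /nbhs_ballP[e /= e0 eB].
have ba0 : 0 < b - a by rewrite subr_gt0.
have vab : 0 <= v b - v a := le_trans (normr_ge0 _) (vu a b a0 (ltW ab) b1).
have vul l := coord_variation_bound l vu.
(* a Riemann sum with [K.+1] nodes is accurate to [e] *)
pose K := Num.truncn ((v b - v a) / e).
have KE : (v b - v a) / K.+1%:R < e.
  rewrite ltr_pdivrMr// mulrC -ltr_pdivrMr//.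
  by have := truncnS_gt ((v b - v a) / e).
pose h := (b - a) / K.+1%:R; have h0 : 0 < h by rewrite divr_gt0.
pose r k := a + k%:R * h.
have rS k : r k <= r k.+1 by rewrite lerD2l ler_pM2r// ler_nat.
have r0 : r 0%N = a by rewrite /r mul0r addr0.
have rK : r K.+1 = b by rewrite /r /h mulrC divfK ?pnatr_eq0// addrC subrK.
have rab k : (k <= K.+1)%N -> a <= r k <= b.
  by move=> kK; rewrite -{1}r0 -rK !(grid_le rS).
have rr k : r k.+1 - r k = h by rewrite /r -natr1; ring.
exists (K.+1%:R^-1 *: \sum_(0 <= k < K.+1) u (r k)); split.
  by apply: convex_mean => // k kK; apply: Uu; apply: rab; exact: leqW.
apply: eB; rewrite -ball_normE/=; apply: le_lt_trans KE.
apply: rV_norm_le; first exact: divr_ge0.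
move=> l; rewrite !mxE summxE.
have bl := variation_bound_measurable (vul l).
have -> : average (fun s => u s 0 l) a b - K.+1%:R^-1 * (\sum_(0 <= k < K.+1) u (r k) 0 l) =
   (b - a)^-1 * \sum_(0 <= k < K.+1) (Int (r k) (r k.+1) (fun s => u s 0 l - u (r k) 0 l)).
  have Ig := @Int_grid r (fun s => u s 0 l) K.+1 rS; rewrite r0 rK in Ig.
  rewrite /average Ig// big_nat [in RHS]big_nat.
  under [in RHS]eq_bigr => k /andP[_ kK].
    have /andP[rk0 rk1] := rab k (ltnW kK); have /andP[rk0' rk1'] := rab k.+1 kK.
    rewrite IntB//; [|exact: le_trans rk0|exact: le_trans b1|exact: bounded_measurable_cst].
    rewrite Int_cst// rr; over.
  rewrite sumrB mulrBr -!big_nat -mulr_suml; congr (_ - _).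
  by rewrite /h; field; rewrite -(natrD _ 1%N K) pnatr_eq0 (gt_eqF ba0).
rewrite normrM gtr0_norm ?invr_gt0// mulrC ler_pdivrMr//.
have -> : (v b - v a) / K.+1%:R * (b - a) = h * (v b - v a) by rewrite /h; ring.
rewrite -{1}rK -{1}r0 -(telescope_sumr (fun k => v (r k)) (leq0n K.+1)) mulr_sumr.
rewrite (le_trans (ler_norm_sum _ _ _))// !big_nat.
apply: ler_sum => k /andP[_ kK].
have /andP[rk0 rk1] := rab k (ltnW kK); have /andP[rk0' rk1'] := rab k.+1 kK.
rewrite -(rr k) mulrC; apply: Int_norm_le => //.
- exact: le_trans rk0.
- exact: le_trans b1.
- exact: (bounded_measurableB bl (bounded_measurable_cst _)).
move=> s /andP[rs sr].
have s0 := le_trans (le_trans a0 rk0) rs.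
rewrite (le_trans (vul l _ _ (le_trans a0 rk0) rs _))//.
  by rewrite (le_trans (ltW sr))// (le_trans rk1').
rewrite lerD2r -subr_ge0.
exact: le_trans (normr_ge0 _) (vu _ _ s0 (ltW sr) (le_trans rk1' b1)).
Qed.

(** On a cell, [g] is replaced by its value at the left end: the replacement costs
the oscillation of [g], and what remains is [g a] times the integral of [z],
which is small by assumption. *)
Lemma weak_cell (z g v gam : R -> R) C a b : 0 <= a -> a <= b -> b <= 1 ->
  bounded_measurable z -> (forall t, 0 <= t <= 1 -> `|z t| <= 1) ->
  variation_bound gam g -> (forall t, 0 <= t <= 1 -> `|g t| <= C) ->
  `|Int a b z| <= (b - a) * (v b - v a) ->
  `|Int a b (fun s => z s * g s)| <=
    (b - a) * (gam b - gam a + C * (v b - v a)).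
Proof.
move=> a0 ab b1 bz z1 gg gC zv; have bg := variation_bound_measurable gg.
have a01 : 0 <= a <= 1 by rewrite a0 (le_trans ab).
have bd : bounded_measurable (fun s => z s * (g s - g a)).
  exact: bounded_measurableM bz (bounded_measurableB bg (bounded_measurable_cst _)).
have bga : bounded_measurable (fun s => g a * z s).
  exact: bounded_measurableM (bounded_measurable_cst _) bz.
rewrite (@eq_Int _ _ (fun s => z s * (g s - g a) + g a * z s) a b)//; first last.
- by move=> s _; ring.
- exact: bounded_measurableD.
- exact: bounded_measurableM.
rewrite IntD// IntZ// (le_trans (ler_normD _ _))// mulrDr lerD//.
  rewrite mulrC; apply: Int_norm_le => // s /andP[as_ sb].
  have s01 : 0 <= s <= 1 by rewrite (le_trans a0)//= (le_trans (ltW sb)).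
  have /andP[s0 s1] := s01.
  rewrite normrM (le_trans (ler_wpM2r _ (z1 _ s01)))// mul1r.
  rewrite (le_trans (gg _ _ a0 as_ s1))// lerD2r -subr_ge0.
  exact: le_trans (normr_ge0 _) (gg _ _ s0 (ltW sb) b1).
rewrite normrM mulrCA ler_pM//; exact: gC.
Qed.

(** Summing [weak_cell] over the complete cells before [t] telescopes; the last,
incomplete cell contributes at most its length times [C]. *)
Lemma weak_estimate (z g v gam : R -> R) C K : (0 < K)%N ->
  bounded_measurable z -> (forall t, 0 <= t <= 1 -> `|z t| <= 1) ->
  variation_bound gam g -> (forall t, 0 <= t <= 1 -> `|g t| <= C) ->
  (forall s t, 0 <= s -> s <= t -> t <= 1 -> v s <= v t) ->
  (forall k, (k < K)%N -> `|Int (k%:R / K%:R) (k.+1%:R / K%:R) z| <=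
      K%:R^-1 * (v (k.+1%:R / K%:R) - v (k%:R / K%:R))) ->
  forall t, 0 <= t <= 1 -> `|Int 0 t (fun s => z s * g s)| <=
    K%:R^-1 * (gam 1 - gam 0 + C * (v 1 - v 0) + C).
Proof.
move=> K0 bz z1 gg gC vm zv t t01.
have KR0 : 0 < K%:R :> R by rewrite ltr0n.
have C0 : 0 <= C := le_trans (normr_ge0 _) (gC _ t01).
pose r k : R := k%:R / K%:R.
have rS k : r k <= r k.+1 by rewrite ler_pM2r ?invr_gt0// ler_nat.
have r0 : r 0%N = 0 by rewrite /r mul0r.
have r_ge0 k : 0 <= r k by rewrite divr_ge0.
have rK : r K = 1 by rewrite /r divff// gt_eqF.
have r1 k : (k <= K)%N -> r k <= 1 by move=> kK; rewrite -rK (grid_le rS).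
have rr k : r k.+1 - r k = K%:R^-1 by rewrite /r -natr1; ring.
have bg := variation_bound_measurable gg.
have bzg : bounded_measurable (fun s => z s * g s) by exact: bounded_measurableM.
(* the error on a cell is the increment of [w] *)
pose w s := K%:R^-1 * (gam s + C * v s).
have gam_mono s : 0 <= s <= 1 -> gam s <= gam 1.
  move=> /andP[s0 s1]; rewrite -subr_ge0; exact: le_trans (normr_ge0 _) (gg _ _ s0 s1 (lexx 1)).
have cells k : (k <= K)%N -> `|Int 0 (r k) (fun s => z s * g s)| <= w (r k) - w 0.
  move=> kK; rewrite -{1}r0 -r0; apply: Int_grid_le => //; rewrite ?r0//.
    exact: r1.
  move=> j jk; have jK : (j < K)%N by exact: leq_trans jk kK.
  have -> : w (r j.+1) - w (r j) =
    (r j.+1 - r j) * (gam (r j.+1) - gam (r j) + C * (v (r j.+1) - v (r j))).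
    by rewrite rr /w; ring.
  apply: weak_cell => //; first exact: r1.
  by rewrite rr; exact: zv.
have w1 s : 0 <= s <= 1 -> w s <= w 1.
  move=> s01; rewrite ler_pM2l ?invr_gt0// lerD ?gam_mono// ler_wpM2l//.
  by case/andP: s01 => *; exact: vm.
have -> : K%:R^-1 * (gam 1 - gam 0 + C * (v 1 - v 0) + C) = (w 1 - w 0) + C / K%:R.
  by rewrite /w; ring.
have /andP[t0 t1] := t01.
have [tlt1|] := ltP t 1; last first.
  move=> t1'; have -> : t = 1 by apply: le_anti; rewrite t1.
  by rewrite -rK (le_trans (cells _ (leqnn _)))// rK lerDl divr_ge0.
pose k := Num.truncn (t * K%:R).
have /andP[k1 k2] : k%:R <= t * K%:R < k.+1%:R by apply: truncn_itv; rewrite mulr_ge0.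
have kt : r k <= t by rewrite ler_pdivrMr.
have tk : t < r k.+1 by rewrite ltr_pdivlMr.
have kK : (k <= K)%N.
  by rewrite -(ler_nat R) (le_trans k1)// -[leRHS]mul1r ler_pM2r.
rewrite (@Int_split _ _ 0 (r k) t)// (le_trans (ler_normD _ _))// lerD//.
  by rewrite (le_trans (cells _ kK))// lerD2r w1// r_ge0 r1.
rewrite (le_trans (@Int_norm_le _ _ (r k) t C _ _ _ _ _))//.
  move=> s /andP[ks st]; have s01 : 0 <= s <= 1.
    by rewrite (le_trans (r_ge0 k) ks)/= (le_trans (ltW st)).
  by rewrite normrM (le_trans (ler_wpM2r _ (z1 _ s01)))// mul1r gC.
by rewrite ler_wpM2l//; have := rr k; lra.
Qed.

Lemma L1_grid_estimate (z v : R -> R) K : (0 < K)%N -> bounded_measurable z ->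
  (forall k s, (k < K)%N -> k%:R / K%:R <= s < k.+1%:R / K%:R ->
     `|z s| <= v (k.+1%:R / K%:R) - v (k%:R / K%:R)) ->
  Int 0 1 (fun s => `|z s|) <= K%:R^-1 * (v 1 - v 0).
Proof.
move=> K0 bz zv; have KR0 : 0 < K%:R :> R by rewrite ltr0n.
pose r k : R := k%:R / K%:R.
have rS k : r k <= r k.+1 by rewrite ler_pM2r ?invr_gt0// ler_nat.
have r0 : r 0%N = 0 by rewrite /r mul0r.
have r_ge0 k : 0 <= r k by rewrite divr_ge0.
have rK : r K = 1 by rewrite /r divff// gt_eqF.
have rr k : r k.+1 - r k = K%:R^-1 by rewrite /r -natr1; ring.
have Ig := @Int_grid_le r (fun s => `|z s|) (fun s => K%:R^-1 * v s) K rS.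
rewrite r0 rK in Ig; rewrite mulrBr (le_trans (ler_norm _))// Ig//.
  exact: bounded_measurable_norm.
move=> k kK; rewrite -mulrBr -{1}(rr k) mulrC; apply: Int_norm_le => //.
- by rewrite -rK (grid_le rS).
- exact: bounded_measurable_norm.
by move=> s ks; rewrite normr_id; exact: zv.
Qed.

End Grids.

(** * From total variation to a dominating monotone function *)

Section TotalVariation.
Context {R : realType}.

Lemma norm1_ge0 k (x : 'rV[R]_k) : 0 <= norm1 x.
Proof. by apply: sumr_ge0. Qed.

Lemma coord_le_norm1 k (x : 'rV[R]_k) i : `|x 0 i| <= norm1 x.
Proof. by rewrite /norm1 (bigD1 i)//= lerDl sumr_ge0. Qed.

Lemma total_variation_coord k (w : R -> 'rV[R]_k) i : in_BV w ->
  (total_variation 0 1 (fun t => w t 0%R i) <= (BVnorm w)%:E)%E.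
Proof.
move=> bw; apply: ge_ereal_sup => _ [_ [s s01 <-] <-]; rewrite lee_fin.
apply: (@le_trans _ _ (\sum_(j < size s)
    norm1 (w (nth 1 (0 :: s) j.+1) - w (nth 1 (0 :: s) j)))); last first.
  by apply: ub_le_sup => //; exists s.
rewrite /variation big_mkord; apply: ler_sum => j _.
by have := coord_le_norm1 (w (nth 1 (0 :: s) j.+1) - w (nth 1 (0 :: s) j)) i; rewrite !mxE.
Qed.

(** Take the sum of the total variations of the coordinates up to time [t], each of
which is at most the total variation of [w]. *)
Lemma variation_bound_of_BV k (w : R -> 'rV[R]_k) : in_BV w ->
  exists2 v, variation_bound v w & v 1 - v 0 <= k%:R * BVnorm w.
Proof.
move=> bw; pose g i (t : R) : R := w t 0 i.
pose TV i (t : R) : \bar R := total_variation 0 t (g i).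
have TV1 i : (TV i 1%R <= (BVnorm w)%:E)%E by exact: total_variation_coord.
have fin i t : 0 <= t <= 1 -> TV i t \is a fin_num.
  move=> /andP[t0 t1]; rewrite ge0_fin_numE ?total_variation_ge0//.
  apply: le_lt_trans (ltry (BVnorm w)); apply: le_trans (TV1 i).
  by rewrite /TV (total_variationD _ t0 t1) leeDl// total_variation_ge0.
exists (fun t => \sum_i fine (TV i t)).
  move=> s t s0 st t1; have t0 := le_trans s0 st.
  have s01 : 0 <= s <= 1 by rewrite s0 (le_trans st).
  have t01 : 0 <= t <= 1 by rewrite t0.
  rewrite -sumrB.
  have H i : `|w t 0 i - w s 0 i| <= fine (TV i t) - fine (TV i s).
    rewrite -lee_fin EFinB !fineK ?fin//.
    rewrite [X in (_ <= X - _)%E]/TV (total_variationD _ s0 st).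
    rewrite addeAC subee ?add0e; last exact: fin.
    exact: total_variation_ge.
  apply: rV_norm_le.
    by apply: sumr_ge0 => i _; exact: le_trans (normr_ge0 _) (H i).
  move=> i; rewrite !mxE (le_trans (H i))// (bigD1 i)//= lerDl.
  by apply: sumr_ge0 => j _; exact: le_trans (normr_ge0 _) (H j).
rewrite -sumrB mulr_natl -[X in _ *+ X]card_ord -sumr_const; apply: ler_sum => i _.
rewrite [X in _ - X](_ : _ = 0) ?subr0; last by rewrite /TV total_variationxx.
by rewrite -lee_fin fineK// fin// lexx ler01.
Qed.

Lemma in_BV_pair m q (u : R -> 'rV[R]_m) (d : R -> 'rV[R]_q) :
  in_BV u -> in_BV d -> in_BV (fun t => row_mx (u t) (d t)).
Proof.
move=> [Bu HBu] [Bd HBd]; exists (Bu + Bd) => _ [s s01 <-].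
apply: le_trans (lerD (HBu _ _) (HBd _ _)); [|by exists s..].
rewrite -big_split/=; apply: ler_sum => j _.
rewrite opp_row_mx add_row_mx /norm1 big_split_ord/=.
by apply: lerD; apply: ler_sum => i _; rewrite ?row_mxEl ?row_mxEr.
Qed.

Lemma BVnorm_ge0 k (w : R -> 'rV[R]_k) : in_BV w -> 0 <= BVnorm w.
Proof.
move=> bw; have p1 : itv_partition 0 1 [:: 1 : R] by exact: itv_partition1.
apply: (@le_trans _ _ (\sum_(j < size [:: 1 : R])
    norm1 (w (nth 1 [:: 0; 1] j.+1) - w (nth 1 [:: 0; 1] j)))).
  by apply: sumr_ge0 => j _; exact: norm1_ge0.
by apply: ub_le_sup => //; exists [:: 1].
Qed.

Lemma pair_variation_bound m q (xi : (R -> 'rV[R]_m) * (R -> 'rV[R]_q)) :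
  in_BV xi.1 -> in_BV xi.2 ->
  exists v, [/\ variation_bound v xi.1, variation_bound v xi.2,
    v 1 - v 0 <= (m + q)%:R * BVnorm_pair xi & 0 <= BVnorm_pair xi].
Proof.
move=> b1 b2; have bp := in_BV_pair b1 b2.
have [v vw v01] := variation_bound_of_BV bp; exists v; split => //.
- move=> s t s0 st t1; apply: le_trans (vw s t s0 st t1).
  apply: rV_norm_le => // i.
  by have := rV_coord_le (row_mx (xi.1 t) (xi.2 t) - row_mx (xi.1 s) (xi.2 s))
    (lshift q i); rewrite opp_row_mx add_row_mx row_mxEl.
- move=> s t s0 st t1; apply: le_trans (vw s t s0 st t1).
  apply: rV_norm_le => // i.
  by have := rV_coord_le (row_mx (xi.1 t) (xi.2 t) - row_mx (xi.1 s) (xi.2 s))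
    (rshift m i); rewrite opp_row_mx add_row_mx row_mxEr.
- exact: BVnorm_ge0.
Qed.

End TotalVariation.

(** * Haar partial sums as dyadic averages *)

Section HaarProjection.
Context {R : realType}.
Local Notation mu := (@lebesgue_measure R).
Local Notation Int a b g := (\int[mu]_(s in `[a, b]) g s).

Lemma bounded_measurable_indic (a b : R) :
  bounded_measurable (\1_(`[a, b[%classic) : R -> R).
Proof.
split; first exact: measurable_indic.
by exists 1 => s _; rewrite indicE; case: (_ \in _); rewrite ?normr1 ?normr0.
Qed.

Lemma Int_indic g (p a b r : R) : 0 <= p -> p <= a -> a <= b -> b <= r -> r <= 1 ->
  bounded_measurable g ->
  Int p r (fun s => g s * \1_(`[a, b[%classic) s) = Int a b g.
Proof.
move=> p0 pa ab br r1 bg.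
have bI := bounded_measurable_indic a b.
have bgI := bounded_measurableM bg bI.
have b0 : bounded_measurable (cst (0 : R)) by exact: bounded_measurable_cst.
have a0 := le_trans p0 pa; have b_ge0 := le_trans a0 ab.
have b1 := le_trans br r1; have a1 := le_trans ab b1.
rewrite (@Int_split _ _ p a r)//; last exact: le_trans br.
rewrite (@Int_split _ _ a b r)//.
rewrite [X in X + _](_ : _ = 0); last first.
  rewrite (@eq_Int _ _ (cst 0))//; first by rewrite Int_cst// mul0r.
  move=> s /andP[_ sa]; rewrite indicE memNset ?mulr0//= in_itv/=.
  by move=> /andP[as_ _]; move: sa; rewrite ltNge as_.
rewrite [X in _ + (_ + X)](_ : _ = 0); last first.
  rewrite (@eq_Int _ _ (cst 0))//; first by rewrite Int_cst// mul0r.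
  move=> s /andP[bs _]; rewrite indicE memNset ?mulr0//= in_itv/=.
  by move=> /andP[_]; rewrite ltNge bs.
rewrite add0r addr0; apply: eq_Int => // s asb.
by rewrite indicE mem_set ?mulr1//= in_itv.
Qed.

Lemma pow2_gt0 n : 0 < (2 ^ n)%:R :> R.
Proof. by rewrite ltr0n expn_gt0. Qed.

Lemma dyadic_double j n : (j.*2)%:R / (2 ^ n.+1)%:R = j%:R / (2 ^ n)%:R :> R.
Proof.
rewrite expnS -mul2n !natrM; have := pow2_gt0 n => /lt0r_neq0.
by move=> ?; field.
Qed.

Lemma dyadic_ge0 j n : 0 <= j%:R / (2 ^ n)%:R :> R.
Proof. by rewrite divr_ge0. Qed.

Lemma dyadic_le1 j n : (j <= 2 ^ n)%N -> j%:R / (2 ^ n)%:R <= 1 :> R.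
Proof. by move=> jn; rewrite ler_pdivrMr ?pow2_gt0// mul1r ler_nat. Qed.

Lemma dyadic_mono i j n : (i <= j)%N -> i%:R / (2 ^ n)%:R <= j%:R / (2 ^ n)%:R :> R.
Proof. by move=> ij; rewrite ler_pM2r ?invr_gt0 ?pow2_gt0// ler_nat. Qed.

Lemma dyadic_step j n : j.+1%:R / (2 ^ n)%:R - j%:R / (2 ^ n)%:R = (2 ^ n)%:R^-1 :> R.
Proof. by rewrite -mulrBl -natr1 addrAC subrr add0r mul1r. Qed.

Lemma dyadic_lt j n : j%:R / (2 ^ n)%:R < j.+1%:R / (2 ^ n)%:R :> R.
Proof. by rewrite -subr_gt0 dyadic_step invr_gt0 pow2_gt0. Qed.

(** Both halves of the support are written on the grid of the next generation, on
which the averages are refined. *)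
Lemma haarE k j (t : R) : haar k j t =
  \1_(`[(j.*2)%:R / (2 ^ k.+1)%:R, j.*2.+1%:R / (2 ^ k.+1)%:R[%classic) t -
  \1_(`[j.*2.+1%:R / (2 ^ k.+1)%:R, j.+1.*2%:R / (2 ^ k.+1)%:R[%classic) t.
Proof.
rewrite !dyadic_double /haar /haar_mother.
have K0 := pow2_gt0 k.
have -> : (2 : R) ^+ k = (2 ^ k)%:R by rewrite natrX.
have mid : j.*2.+1%:R / (2 ^ k.+1)%:R = (j%:R + 2^-1) / (2 ^ k)%:R :> R.
  rewrite expnS -natr1 -mul2n !natrM; move/lt0r_neq0: K0 => ?; by field.
have -> : (0 <= (2 ^ k)%:R * t - j%:R) = (j%:R / (2 ^ k)%:R <= t).
  by rewrite subr_ge0 ler_pdivrMr// mulrC.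
have -> : ((2 ^ k)%:R * t - j%:R < 2^-1) = (t < j.*2.+1%:R / (2 ^ k.+1)%:R).
  by rewrite mid ltr_pdivlMr// ltrBlDr addrC (mulrC t).
have -> : (2^-1 <= (2 ^ k)%:R * t - j%:R) = (j.*2.+1%:R / (2 ^ k.+1)%:R <= t).
  by rewrite mid ler_pdivrMr// lerBrDr addrC (mulrC t).
have -> : ((2 ^ k)%:R * t - j%:R < 1) = (t < j.+1%:R / (2 ^ k)%:R).
  by rewrite ltr_pdivlMr// ltrBlDr (mulrC t) nat1r.
rewrite !indicE !mem_setE !in_itv/= (leNgt (j.*2.+1%:R / _) t).
by case: (j%:R / _ <= t); case: (t < j.*2.+1%:R / _) => //=; case: (t < _); rewrite /= ?subr0 ?sub0r.
Qed.

Lemma bounded_measurable_haar k j : bounded_measurable (haar k j : R -> R).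
Proof.
apply: eq_bounded_measurable (fun t _ => esym (haarE k j t)) _.
exact: bounded_measurableB (bounded_measurable_indic _ _) (bounded_measurable_indic _ _).
Qed.

Lemma L2dot_haar g k j : bounded_measurable g -> (j < 2 ^ k)%N ->
  L2dot g (haar k j) =
  Int ((j.*2)%:R / (2 ^ k.+1)%:R) (j.*2.+1%:R / (2 ^ k.+1)%:R) g -
  Int (j.*2.+1%:R / (2 ^ k.+1)%:R) (j.+1.*2%:R / (2 ^ k.+1)%:R) g.
Proof.
move=> bg jk; rewrite /L2dot.
have b1 : j.+1.*2%:R / (2 ^ k.+1)%:R <= 1 :> R by rewrite dyadic_double dyadic_le1.
have lt1 := ltW (dyadic_lt j.*2 k.+1); have lt2 := ltW (dyadic_lt j.*2.+1 k.+1).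
under eq_Rintegral do rewrite haarE mulrBr.
have m1 a b := bounded_measurableM bg (bounded_measurable_indic a b).
by rewrite IntB// !Int_indic// ?dyadic_ge0//; exact: le_trans b1.
Qed.

Lemma L2norm_haar k j : (j < 2 ^ k)%N -> L2norm (haar k j) ^+ 2 = (2 ^ k)%:R^-1 :> R.
Proof.
move=> jk; rewrite /L2norm sqr_sqrtr; last first.
  by apply: Rintegral_ge0 => t _; rewrite -expr2 sqr_ge0.
have bh := bounded_measurable_haar k j.
have b1 : j.+1.*2%:R / (2 ^ k.+1)%:R <= 1 :> R by rewrite dyadic_double dyadic_le1.
have lt1 := ltW (dyadic_lt j.*2 k.+1); have lt2 := ltW (dyadic_lt j.*2.+1 k.+1).
have c0 : 0 <= j.*2%:R / (2 ^ k.+1)%:R :> R by exact: dyadic_ge0.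
have bc c := bounded_measurable_cst c.
rewrite L2dot_haar// (@eq_Int _ _ (cst 1))//; first last.
- move=> s /andP[s1 s2]; rewrite haarE !indicE mem_set/=; last by rewrite in_itv/= s1.
  by rewrite memNset ?subr0//= in_itv/= leNgt s2.
- exact: le_trans b1.
rewrite [X in _ - X](@eq_Int _ _ (cst (-1)))//; first last.
- move=> s /andP[s1 s2]; rewrite haarE !indicE [in X in _ - X]mem_set/=; last by rewrite in_itv/= s1.
  by rewrite memNset ?sub0r//= in_itv/= ltNge s1 andbF.
rewrite !Int_cst// mul1r mulN1r opprK dyadic_step.
have := @dyadic_step j.*2.+1 k.+1; rewrite -doubleS => ->.
by rewrite expnS natrM; move/lt0r_neq0: (pow2_gt0 k) => ?; field.
Qed.

(** [haar_sum N] is the case [n = N.+1]; starting from [n = 0], where only the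
mean is left, makes induction on the number of generations possible. *)
Definition haar_partial_sum n (c : R -> R) (t : R) : R :=
  L2dot c (cst 1) +
  \sum_(0 <= k < n) \sum_(0 <= j < 2 ^ k)
    L2dot c (haar k j) * (haar k j t / L2norm (haar k j) ^+ 2).

Lemma haar_out k i j (t : R) : i != j ->
  j%:R / (2 ^ k)%:R <= t < j.+1%:R / (2 ^ k)%:R -> haar k i t = 0.
Proof.
move=> ij /andP[jt tj]; rewrite haarE !dyadic_double.
move: ij; rewrite neq_ltn => /orP[ij|ji].
  rewrite !indicE !memNset ?subr0//= in_itv/=; apply/negP; rewrite negb_and -!leNgt -ltNge.
    by rewrite (le_trans _ jt) ?orbT// dyadic_mono.
  rewrite (le_trans _ jt) ?orbT// (le_trans _ (dyadic_mono _ ij))//.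
  by rewrite -dyadic_double; exact/ltW/dyadic_lt.
have it : t < i%:R / (2 ^ k)%:R by apply: lt_le_trans tj _; exact: dyadic_mono.
rewrite !indicE !memNset ?subr0//= in_itv/=; apply/negP; rewrite negb_and -!leNgt -ltNge.
  rewrite (lt_trans it)// -dyadic_double; exact/dyadic_lt.
by rewrite it.
Qed.

(** At a point of a cell of generation [n] a single Haar function of that
generation does not vanish.  Its term is plus or minus half the difference of
the averages over the two halves, which turns the average over the cell into
the average over the half that contains the point. *)
Lemma haar_partial_sum_average n c j t : bounded_measurable c ->
  (j < 2 ^ n)%N -> j%:R / (2 ^ n)%:R <= t < j.+1%:R / (2 ^ n)%:R ->
  haar_partial_sum n c t = average c (j%:R / (2 ^ n)%:R) (j.+1%:R / (2 ^ n)%:R).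
Proof.
move=> bc; elim: n j => [|n IH] j'.
  rewrite expn0 ltnS leqn0 => /eqP-> _.
  rewrite /haar_partial_sum big_geq// addr0 mul0r divr1 /average subr0 invr1 mul1r.
  by apply: eq_Rintegral => s _; rewrite mulr1.
move=> jn' jt'.
pose j := j'./2.
have jn : (j < 2 ^ n)%N.
  by rewrite /j ltn_half_double -mul2n -expnS.
have jE : j' = (odd j' + j.*2)%N by rewrite odd_double_half.
have jt : j%:R / (2 ^ n)%:R <= t < j.+1%:R / (2 ^ n)%:R.
  rewrite -(dyadic_double j) -(dyadic_double j.+1); move: jt' => /andP[t1 t2]; apply/andP; split.
    by apply: le_trans t1; apply: dyadic_mono; rewrite [leqRHS]jE leq_addl.
  apply: lt_le_trans t2 _; apply: dyadic_mono.
  by rewrite [in leqLHS]jE doubleS ltnS; case: (odd j').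
rewrite /haar_partial_sum big_nat_recr//= addrA -/(haar_partial_sum n c t).
rewrite (IH j)// big_mkord (bigD1 (Ordinal jn))//= big1 ?addr0; last first.
  move=> i ij; rewrite (@haar_out n i j)//; first by rewrite mul0r mulr0.
rewrite L2norm_haar// invrK L2dot_haar//.
have b1 : j.+1.*2%:R / (2 ^ n.+1)%:R <= 1 :> R by rewrite dyadic_double dyadic_le1.
have lt1 := dyadic_lt j.*2 n.+1; have lt2 := dyadic_lt j.*2.+1 n.+1.
rewrite -doubleS in lt2.
have c0 : 0 <= j.*2%:R / (2 ^ n.+1)%:R :> R by exact: dyadic_ge0.
rewrite {1}/average dyadic_step invrK -(dyadic_double j) -(dyadic_double j.+1).
rewrite (@Int_split _ _ _ (j.*2.+1%:R / (2 ^ n.+1)%:R))//; [|exact: ltW..].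
rewrite /average dyadic_step invrK.
have K2 : (2 ^ n.+1)%:R = 2 * (2 ^ n)%:R :> R by rewrite expnS natrM.
move: jt' => /andP[t1 t2].
case: (boolP (odd j')) jE => oj jE.
  rewrite add1n in jE; rewrite jE -doubleS in t1 t2 *.
  rewrite haarE !indicE memNset/=; last by rewrite in_itv/= [X in _ && X]ltNge t1 andbF.
  rewrite mem_set/=; last by rewrite in_itv/= t1.
  by rewrite K2; ring.
rewrite add0n in jE; rewrite jE in t1 t2 *.
rewrite haarE !indicE mem_set/=; last by rewrite in_itv/= t1.
rewrite memNset/=; last by rewrite in_itv/= leNgt t2.
by rewrite K2; ring.
Qed.

Lemma haar_proj_average N n (w : R -> 'rV[R]_n) j t i :
  (forall i, bounded_measurable (fun s => w s 0 i)) ->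
  (j < 2 ^ N.+1)%N -> j%:R / (2 ^ N.+1)%:R <= t < j.+1%:R / (2 ^ N.+1)%:R ->
  haar_proj N w t 0 i =
  average (fun s => w s 0 i) (j%:R / (2 ^ N.+1)%:R) (j.+1%:R / (2 ^ N.+1)%:R).
Proof.
move=> bw jN jt; rewrite mxE /extend_left ifF; last first.
  by apply: lt_eqF; case/andP: jt => _ /lt_le_trans; apply; exact: dyadic_le1.
exact: haar_partial_sum_average.
Qed.

End HaarProjection.

(** * Pulse-width modulation *)

Section Pulses.
Context {R : realType} (N q : nat).
Local Notation mu := (@lebesgue_measure R).
Local Notation Int a b g := (\int[mu]_(s in `[a, b]) g s).
Local Notation K := (2 ^ N)%N.
Variable D : R -> 'rV[R]_q.
Hypothesis D_ge0 : forall k i, (k < K)%N -> 0 <= D (k%:R / K%:R) 0 i.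
Hypothesis D_sum : forall k, (k < K)%N -> \sum_i D (k%:R / K%:R) 0 i = 1.

(** The pulse of index [i] in cell [k] occupies the interval from [lo k i] to
[hi k i]. *)
Let lo k (i : 'I_q) := (k%:R + \sum_(j < q | (j < i)%N) D (k%:R / K%:R) 0 j) / K%:R.
Let hi k (i : 'I_q) := (k%:R + \sum_(j < q | (j <= i)%N) D (k%:R / K%:R) 0 j) / K%:R.

Lemma pulse_width k i : hi k i - lo k i = D (k%:R / K%:R) 0 i / K%:R.
Proof.
rewrite /hi /lo -mulrBl opprD addrACA subrr add0r (bigD1 i)//=.
rewrite (eq_bigl (fun j : 'I_q => (j < i)%N)) ?addrK// => j.
by rewrite ltn_neqAle andbC.
Qed.

Lemma pulse_bounds k i : (k < K)%N ->
  [/\ k%:R / K%:R <= lo k i, lo k i <= hi k i & hi k i <= k.+1%:R / K%:R].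
Proof.
move=> kK; have K0 : 0 < K%:R :> R by exact: pow2_gt0.
split.
- rewrite ler_pM2r ?invr_gt0// lerDl; apply: sumr_ge0 => j _; exact: D_ge0.
- by rewrite -subr_ge0 pulse_width divr_ge0// D_ge0.
rewrite ler_pM2r ?invr_gt0// -natr1 lerD2l -[leRHS](D_sum kK).
rewrite [leRHS](bigID (fun j : 'I_q => (j <= i)%N))/= lerDl.
by apply: sumr_ge0 => j _; exact: D_ge0.
Qed.

Lemma pulse_cond k (i : 'I_q) t :
  (2 ^- N * (k%:R + \sum_(j < q | (j < i)%N) D (k%:R / 2 ^+ N) 0 j) <= t <
   2 ^- N * (k%:R + \sum_(j < q | (j <= i)%N) D (k%:R / 2 ^+ N) 0 j))
  = (lo k i <= t < hi k i).
Proof. by rewrite /lo /hi !(mulrC (2 ^- N)) natrX. Qed.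

(** Pulses of other cells do not reach into cell [k], since the partial sums of
the duty cycles [D] lie between 0 and 1. *)
Lemma pulse_cell k i t : (k < K)%N -> k%:R / K%:R <= t < k.+1%:R / K%:R ->
  pulse N D i t = \1_(`[lo k i, hi k i[%classic) t.
Proof.
move=> kK /andP[kt tk]; rewrite /pulse indicE mem_setE in_itv/=.
rewrite (_ : [exists k' : 'I_(2 ^ N), _] = (lo k i <= t < hi k i)).
  by case: ifP.
apply/existsP/idP => [[k' ]|H]; last by exists (Ordinal kK); rewrite pulse_cond.
rewrite pulse_cond => /andP[t1 t2].
have [b1 _ b2] := pulse_bounds i (ltn_ord k').
have [lt1|lt2|eqk] := ltngtP k k'.
- have := le_trans (le_trans (dyadic_mono N lt1) b1) t1.
  by rewrite leNgt tk.
- have := lt_le_trans t2 (le_trans b2 (dyadic_mono N lt2)).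
  by rewrite ltNge kt.
- by rewrite -eqk in t1 t2; rewrite t1.
Qed.

Lemma pulse01 i t : 0 <= pulse N D i t <= 1.
Proof. by rewrite /pulse; case: ifP; rewrite lexx ler01. Qed.

Lemma bounded_measurable_pulse i : bounded_measurable (pulse N D i).
Proof.
split; last first.
  by exists 1 => s _; have /andP[p0 p1] := pulse01 i s; rewrite ger0_norm.
pose A := \bigcup_(k in [set: 'I_K]) `[lo k i, hi k i[%classic : set R.
have mA : measurable A by apply: fin_bigcup_measurable.
rewrite (_ : pulse N D i = \1_A); first exact: measurable_indic.
apply/funext => t; rewrite /pulse indicE.
rewrite (_ : [exists k' : 'I_(2 ^ N), _] = (t \in A)); first by case: (t \in A).
apply/existsP/idP => [[k]|].
  by rewrite pulse_cond => H; apply/mem_set; exists k => //=; rewrite in_itv.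
by move=> /set_mem[k _ /=]; rewrite in_itv/= => H; exists k; rewrite pulse_cond.
Qed.

Lemma Int_pulse k i : (k < K)%N ->
  Int (k%:R / K%:R) (k.+1%:R / K%:R) (pulse N D i) = D (k%:R / K%:R) 0 i / K%:R.
Proof.
move=> kK; have [b1 b2 b3] := pulse_bounds i kK.
have bc : bounded_measurable (cst (1 : R)) by exact: bounded_measurable_cst.
have c0 := @dyadic_ge0 R k N; have c1 := @dyadic_le1 R k.+1 N kK.
rewrite (@eq_Int _ _ (fun s => cst 1 s * \1_(`[lo k i, hi k i[%classic) s))//.
- by rewrite Int_indic// Int_cst// mul1r pulse_width.
- exact: bounded_measurable_pulse.
- exact: bounded_measurableM bc (bounded_measurable_indic _ _).
- by move=> s ks; rewrite mul1r (pulse_cell i kK ks).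
Qed.

End Pulses.

(** * Approximation errors of the discretized controls *)

Section Discretization.
Context {R : realType} (m q N : nat).
Local Notation mu := (@lebesgue_measure R).
Local Notation Int a b g := (\int[mu]_(s in `[a, b]) g s).

Lemma variation_bound_between (V : normedZmodType R) v (w : R -> V) a b r s :
  variation_bound v w -> 0 <= a -> b <= 1 -> a <= r <= b -> a <= s <= b ->
  `|w r - w s| <= v b - v a.
Proof.
move=> vw a0 b1.
have v_mono x y : a <= x -> x <= y -> y <= b -> v x <= v y.
  move=> ax xy yb; rewrite -subr_ge0.
  exact: le_trans (normr_ge0 _) (vw x y (le_trans a0 ax) xy (le_trans yb b1)).
wlog rs : r s / r <= s.
  move=> H; have [rs|sr] := leP r s; first exact: H.
  by move=> hr hs; rewrite distrC H// ltW.
move=> /andP[ar rb] /andP[as_ sb]; rewrite distrC.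
rewrite (le_trans (vw _ _ (le_trans a0 ar) rs (le_trans sb b1)))//.
by rewrite lerB// v_mono.
Qed.

Lemma average_variation v (g : R -> R) a c b s : variation_bound v g ->
  0 <= a -> a < c -> c <= b -> b <= 1 -> a <= s < b ->
  `|average g a c - g s| <= v b - v a.
Proof.
move=> vg a0 ac cb b1 /andP[as_ sb].
apply: average_dist => //; first exact: le_trans b1.
  exact: variation_bound_measurable vg.
move=> r /andP[ar rc]; apply: (variation_bound_between vg) => //.
  by rewrite ar (le_trans (ltW rc)).
by rewrite as_ ltW.
Qed.

Section Control.
Variables (U : set 'rV[R]_m) (v : R -> R) (u : R -> 'rV[R]_m).
Hypothesis cU : convex_set (U : set (convex_lmodType 'rV[R]_m)).
Hypothesis vu : variation_bound v u.
Hypothesis uU : forall t, 0 <= t <= 1 -> U (u t).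

Local Notation K := (2 ^ N.+1)%N.

(** The minimum only serves to put time 1 in the last cell. *)
Definition cell (t : R) : nat := minn (Num.truncn (t * K%:R)) K.-1.

Definition cell_mean (j : nat) : 'rV[R]_m :=
  \row_l average (fun s => u s 0 l) (j%:R / K%:R) (j.+1%:R / K%:R).

Lemma cell_lt t : (cell t < K)%N.
Proof. by rewrite /cell -[ltnRHS](prednK (expn_gt0 2 N.+1)) ltnS geq_minr. Qed.

Lemma cellP t : 0 <= t < 1 -> (cell t)%:R / K%:R <= t < (cell t).+1%:R / K%:R.
Proof.
move=> /andP[t0 t1]; have K0 := @pow2_gt0 R N.+1.
have tK : t * K%:R < K%:R by rewrite gtr_pMl.
have tr := truncn_itv (mulr_ge0 t0 (ltW K0)).
have -> : cell t = Num.truncn (t * K%:R).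
  apply/minn_idPl; rewrite -ltnS prednK ?expn_gt0//.
  by rewrite truncn_lt_nat// mulr_ge0// ltW.
by rewrite ler_pdivrMr// ltr_pdivlMr.
Qed.

Lemma cell_unique t j : (j < K)%N -> j%:R / K%:R <= t < j.+1%:R / K%:R -> cell t = j.
Proof.
move=> jK /andP[jt tj]; have K0 := @pow2_gt0 R N.+1.
rewrite /cell (_ : Num.truncn _ = j); last first.
  by apply: truncn_def; rewrite -ler_pdivrMr// jt -ltr_pdivlMr.
by apply/minn_idPl; rewrite -ltnS prednK ?expn_gt0.
Qed.

Lemma cell_mono s t : s <= t -> (cell s <= cell t)%N.
Proof.
move=> st; rewrite /cell leq_min !geq_min leqnn !orbT andbT; apply/orP; left.
by apply: le_truncn; rewrite ler_pM2r// pow2_gt0.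
Qed.

Lemma cell_mean_closure j : (j < K)%N -> closure U (cell_mean j).
Proof.
move=> jK; apply: average_closure cU vu _ _ _ _ => //.
- exact: dyadic_lt.
- exact: dyadic_le1.
move=> t /andP[jt tj]; apply: uU.
by rewrite (le_trans (dyadic_ge0 j N.+1) jt) (le_trans tj)// dyadic_le1.
Qed.

(** A step function jumps only where the index of the cell increases, and each
jump is at most twice the largest value. *)
Lemma cell_mean_variation : exists w, variation_bound w (fun t => cell_mean (cell t)).
Proof.
pose M := \sum_(j < K) `|cell_mean j|.
have HM j : (j < K)%N -> `|cell_mean j| <= M.
  by move=> jK; rewrite /M (bigD1 (Ordinal jK))//= lerDl sumr_ge0.
exists (fun t => 2 * M * (cell t)%:R) => s t _ st _.
have := cell_mono st; rewrite leq_eqVlt => /predU1P[->|lt_st].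
  by rewrite !subrr normr0.
rewrite -mulrBr (le_trans (ler_normB _ _))//.
have M0 : 0 <= M by apply: sumr_ge0.
rewrite (le_trans (lerD (HM _ (cell_lt t)) (HM _ (cell_lt s))))//.
rewrite -mulr2n -[leLHS]mulr_natl ler_peMr ?mulr_ge0//.
by rewrite lerBrDr nat1r ler_nat.
Qed.

Lemma cell_mean_L1 l :
  Int 0 1 (fun s => `|cell_mean (cell s) 0 l - u s 0 l|) <= (2 ^ N)%:R^-1 * (v 1 - v 0).
Proof.
have [w vw] := cell_mean_variation.
have bz := bounded_measurableB
  (variation_bound_measurable (coord_variation_bound l vw))
  (variation_bound_measurable (coord_variation_bound l vu)).
apply: le_trans (@L1_grid_estimate R (fun s => cell_mean (cell s) 0 l - u s 0 l) v K _ bz _) _.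
- by rewrite expn_gt0.
- move=> k s kK ks; rewrite (cell_unique kK ks) mxE.
  apply: (average_variation (coord_variation_bound l vu)) ks => //.
  + exact: dyadic_lt.
  + exact: dyadic_le1.
rewrite ler_wpM2r//.
  by rewrite (le_trans (normr_ge0 _) (vu (lexx 0) ler01 (lexx 1))).
by rewrite lef_pV2 ?posrE ?pow2_gt0// ler_nat leq_exp2l.
Qed.

Lemma haar_proj_cell t : 0 <= t < 1 -> haar_proj N u t = cell_mean (cell t).
Proof.
move=> t01; apply/rowP => l; rewrite [RHS]mxE.
apply: (haar_proj_average l _ (cell_lt t) (cellP t01)) => i.
exact: variation_bound_measurable (coord_variation_bound i vu).
Qed.

End Control.

Section SwitchingControl.
Variables (v : R -> R) (d : R -> 'rV[R]_q).
Hypothesis vd : variation_bound v d.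
Hypothesis dS : forall t, 0 <= t <= 1 -> @Sigma_r R q (d t).

Local Notation K := (2 ^ N)%N.

Let bd i : bounded_measurable (fun s => d s 0 i).
Proof. exact: variation_bound_measurable (coord_variation_bound i vd). Qed.

Let aK k := (k.*2)%:R / (2 ^ N.+1)%:R : R.
Let cK k := (k.*2.+1)%:R / (2 ^ N.+1)%:R : R.

(** The projection resolves cells of generation [N.+1], so its sample at the left
end of a cell of generation [N] is the average over the first half of that
cell. *)
Lemma haar_proj_sample k i : (k < K)%N ->
  haar_proj N d (k%:R / K%:R) 0 i = average (fun s => d s 0 i) (aK k) (cK k).
Proof.
move=> kK; apply: (@haar_proj_average R N q d k.*2) => //.
  by rewrite expnS mul2n ltn_double.
by rewrite -dyadic_double lexx dyadic_lt.
Qed.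

Let aK0 k : 0 <= aK k. Proof. exact: dyadic_ge0. Qed.
Let cK1 k : (k < K)%N -> cK k <= 1.
Proof. by move=> kK; apply: dyadic_le1; rewrite expnS mul2n ltn_double. Qed.
Let acK k : aK k < cK k. Proof. exact: dyadic_lt. Qed.

Let in01 k s : (k < K)%N -> aK k <= s < cK k -> 0 <= s <= 1.
Proof.
move=> kK /andP[as_ sc]; rewrite (le_trans (aK0 k) as_)/=.
exact: le_trans (ltW sc) (cK1 kK).
Qed.

Lemma haar_proj_sample_ge0 k i : (k < K)%N -> 0 <= haar_proj N d (k%:R / K%:R) 0 i.
Proof.
move=> kK; rewrite haar_proj_sample// mulr_ge0 ?invr_ge0 ?subr_ge0 ?(ltW (acK k))//.
apply: Rintegral_ge0 => s; rewrite /= in_itv/= => /andP[s1 s2].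
have s01 : 0 <= s <= 1 by rewrite (le_trans (aK0 k) s1) (le_trans s2 (cK1 kK)).
by have [/(_ i)/andP[]] := dS s01.
Qed.

Lemma haar_proj_sample_sum k : (k < K)%N -> \sum_i haar_proj N d (k%:R / K%:R) 0 i = 1.
Proof.
move=> kK; under eq_bigr do rewrite haar_proj_sample//.
rewrite /average -mulr_sumr -Int_sum//; last exact: cK1.
rewrite (@eq_Int _ _ (cst 1))//; first last.
- by move=> s /(in01 kK)/dS[].
- exact: bounded_measurable_cst.
- exact: bounded_measurable_sum.
- exact: cK1.
rewrite Int_cst ?(ltW (acK k))// mul1r mulVf// subr_eq0.
by rewrite gt_eqF.
Qed.

Local Notation p := (fun i t => pulse N (haar_proj N d) i t).

(** The integral of the pulse is the length of the cell times the sample; the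
sample, an average over half the cell, is within the variation on the cell of
every value taken there. *)
Lemma pulse_cell_error k i : (k < K)%N ->
  `|Int (k%:R / K%:R) (k.+1%:R / K%:R) (fun s => p i s - d s 0 i)| <=
  K%:R^-1 * (v (k.+1%:R / K%:R) - v (k%:R / K%:R)).
Proof.
move=> kK; have c0 := @dyadic_ge0 R k N; have c1 := @dyadic_le1 R k.+1 N kK.
have lt1 := ltW (@dyadic_lt R k N).
have bp : bounded_measurable (pulse N (haar_proj N d) i).
  exact: bounded_measurable_pulse.
rewrite IntB// (Int_pulse haar_proj_sample_ge0 haar_proj_sample_sum)//.
pose D := haar_proj N d (k%:R / K%:R) 0 i.
have -> : D / K%:R = Int (k%:R / K%:R) (k.+1%:R / K%:R) (cst D).
  by rewrite Int_cst// dyadic_step.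
rewrite -IntB//; last exact: bounded_measurable_cst.
rewrite -[X in _ <= X * _](dyadic_step k N) [leRHS]mulrC; apply: Int_norm_le => //.
  exact: (bounded_measurableB (bounded_measurable_cst _) (bd i)).
move=> s ks; rewrite /D haar_proj_sample// -(dyadic_double k N).
apply: (average_variation (coord_variation_bound i vd)) => //.
- by rewrite -dyadic_double; apply: dyadic_mono; rewrite doubleS.
- by rewrite /aK dyadic_double.
Qed.

End SwitchingControl.

End Discretization.

(** * The error of the discretized trajectory *)

Section Main.
Context {R : realType} (n m q : nat).
Local Notation mu := (@lebesgue_measure R).
Local Notation Int a b g := (\int[mu]_(s in `[a, b]) g s).

(** [rho N xi] up to its value at time 1, which is chosen so that the control is
admissible there too. *)
Definition discrete_control N (xi : (R -> 'rV[R]_m) * (R -> 'rV[R]_q)) :=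
  (fun t => cell_mean N xi.1 (cell N t),
   fun t => \row_i pulse N (haar_proj N xi.2) i t) :
  (R -> 'rV[R]_m) * (R -> 'rV[R]_q).

Variables (U : set 'rV[R]_m) (xi : (R -> 'rV[R]_m) * (R -> 'rV[R]_q)) (v : R -> R).
Hypothesis cU : convex_set (U : set (convex_lmodType 'rV[R]_m)).
Hypothesis vu : variation_bound v xi.1.
Hypothesis vd : variation_bound v xi.2.
Hypothesis uU : forall t, 0 <= t <= 1 -> U (xi.1 t).
Hypothesis dS : forall t, 0 <= t <= 1 -> @Sigma_r R q (xi.2 t).

Lemma rho_discrete_control N s : 0 <= s < 1 ->
  (rho N xi).1 s = (discrete_control N xi).1 s /\
  (rho N xi).2 s = (discrete_control N xi).2 s.
Proof.
move=> s01; split; first exact: (haar_proj_cell N vu s01).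
apply/rowP => i; rewrite !mxE /extend_left ifF//.
by case/andP: s01 => _ /lt_eqF.
Qed.

Lemma admissible_xi : admissible U v xi.1 xi.2.
Proof.
split => //.
- by move=> t /uU; exact: subset_closure.
- by move=> i; exact: variation_bound_measurable (coord_variation_bound i vd).
- by move=> t i /dS[].
Qed.

Lemma admissible_discrete_control N : exists w,
  admissible U w (discrete_control N xi).1 (discrete_control N xi).2.
Proof.
have [w vw] := cell_mean_variation N xi.1; exists w; split => //=.
- by move=> t _; apply: (cell_mean_closure cU vu uU); exact: cell_lt.
- move=> i; apply: (@eq_bounded_measurable _ (pulse N (haar_proj N xi.2) i)).
    by move=> s _; rewrite mxE.
  exact: bounded_measurable_pulse.
- by move=> t i _; rewrite mxE pulse01.
Qed.

Variables (x0 : 'rV[R]_n) (f : 'I_q -> R -> 'rV[R]_n -> 'rV[R]_m -> 'rV[R]_n).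
Variables (Lam0 C0 : R).
Hypotheses (Lam0_gt0 : 0 < Lam0) (C0_ge0 : 0 <= C0) (q_gt0 : (0 < q)%N).
Hypothesis fU : sup_lipschitz f (closure U) Lam0.
Hypothesis fC : forall i t u, 0 <= t <= 1 -> closure U u -> `|f i t x0 u| <= C0.

Let Lam := q%:R * Lam0.
Let C := q%:R * C0.
Let W1 := weight Lam 1.
Let S := speed Lam C.
Let Cg := C0 + Lam0 * (2 * C * W1).

(** Coefficients of the final bound as an affine function of the variation; they
depend on neither the control nor [N]. *)
Definition gap_slope := Lam0 * m%:R + Lam0 + Cg.
Definition gap_offset := Lam0 * (1 + S) + Cg.

(** In [weak_estimate], [g] is a coordinate of the field along the original
trajectory: [S] and [v] control its variation, [Cg] its size. *)
Lemma trajectory_gap N t : 0 <= t <= 1 ->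
  `|phi f x0 t (rho N xi) - phi f x0 t xi| <=
  2 * ((2 ^ N)%:R^-1 * (q%:R * (gap_slope * (v 1 - v 0) + gap_offset))) * W1.
Proof.
move=> t01.
have Lam_gt0 : 0 < Lam by rewrite mulr_gt0// ltr0n.
have W0 : 0 <= W1 by exact: expR_ge0.
have C_ge0 : 0 <= C by rewrite mulr_ge0.
have Cg0 : 0 <= Cg by rewrite addr_ge0// mulr_ge0 ?(ltW Lam0_gt0)// !mulr_ge0.
have S0 : 0 <= S by rewrite /S /speed addr_ge0// mulr_ge0 ?(ltW Lam_gt0)// !mulr_ge0.
have dv0 : 0 <= v 1 - v 0 := le_trans (normr_ge0 _) (vu (lexx 0) ler01 (lexx 1)).
rewrite (phi_eq_ae f x0 t (@rho_discrete_control N)).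
have ad := admissible_xi; have [w ad'] := admissible_discrete_control N.
have GH := admissible_caratheodory Lam0_gt0 fU fC ad.
have GH' := admissible_caratheodory Lam0_gt0 fU fC ad'.
have [lx xE] := trajectory_picard_fixpoint Lam_gt0 GH (phi_trajectory Lam_gt0 GH).
have [lx' xE'] := trajectory_picard_fixpoint Lam_gt0 GH' (phi_trajectory Lam_gt0 GH').
set x := fun t => phi f x0 t xi in lx xE *.
have [xC vx] := solution_speed Lam_gt0 GH lx xE.
pose eta := (2 ^ N)%:R^-1 * (v 1 - v 0).
pose E := (2 ^ N)%:R^-1 *
  (Lam0 * (1 + S * 1 + v 1) - Lam0 * (0 + S * 0 + v 0) + Cg * (v 1 - v 0) + Cg).
have HE i l s : 0 <= s <= 1 -> `|Int 0 s (fun r =>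
    ((discrete_control N xi).2 r 0 i - xi.2 r 0 i) * f i r (x r) (xi.1 r) 0 l)| <= E.
  move=> s01; rewrite /=.
  under eq_Rintegral do rewrite mxE.
  have bp := bounded_measurable_pulse N (haar_proj N xi.2) i.
  apply: (weak_estimate _ _ _ (field_along_variation Lam0_gt0 fU i l ad vx)) s01.
  - by rewrite expn_gt0.
  - apply: bounded_measurableB bp _.
    exact: variation_bound_measurable (coord_variation_bound i vd).
  - move=> r r01; have /andP[p0 p1] := pulse01 N (haar_proj N xi.2) i r.
    have [/(_ i)/andP[d0 d1] _] := dS r01.
    rewrite ler_norml; lra.
  - move=> r r01; apply: le_trans (rV_coord_le _ _) _.
    have cu := subset_closure (uU r01).
    rewrite -(subrK (f i r x0 (xi.1 r)) (f i r (x r) (xi.1 r))) addrC.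
    rewrite (le_trans (ler_normD _ _))// lerD ?fC//.
    rewrite (le_trans (fU _ _ _ r01 r01 cu cu))//.
    rewrite !subrr !normr0 add0r addr0 ler_pM2l// (le_trans (xC _ r01))//.
    rewrite ler_wpM2l ?mulr_ge0//; apply: weight_le => //.
    by case/andP: r01.
  - move=> y z y0 yz z1; rewrite -subr_ge0.
    exact: le_trans (normr_ge0 _) (vu y0 yz z1).
  - by move=> k kN; exact: pulse_cell_error.
have AE : q%:R * (Lam0 * (m%:R * eta) + E) =
    (2 ^ N)%:R^-1 * (q%:R * (gap_slope * (v 1 - v 0) + gap_offset)).
  by rewrite /eta /E /gap_slope /gap_offset; ring.
have A0 : 0 <= q%:R * (Lam0 * (m%:R * eta) + E).
  have gs0 : 0 <= gap_slope.
    by apply: addr_ge0 => //; apply: addr_ge0; rewrite ?mulr_ge0 ?(ltW Lam0_gt0).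
  have go0 : 0 <= gap_offset.
    by apply: addr_ge0 => //; rewrite mulr_ge0 ?(ltW Lam0_gt0)// addr_ge0.
  rewrite AE; apply: mulr_ge0; rewrite ?invr_ge0//; apply: mulr_ge0 => //.
  by apply: addr_ge0 => //; exact: mulr_ge0.
have := stability Lam0_gt0 fU fC q_gt0 ad ad' lx lx' xE xE'
  (cell_mean_L1 N vu) HE erefl A0 t01.
move=> /le_trans; apply; rewrite -AE; apply: ler_wpM2l; first exact: mulr_ge0.
by apply: weight_le => //; case/andP: t01.
Qed.

End Main.

Theorem theorem6 (R : realType) (n m q : nat)
  (n_gt0 : (0 < n)%N) (m_gt0 : (0 < m)%N) (q_gt0 : (0 < q)%N)
  (x0 : 'rV[R]_n) (U : set 'rV[R]_m)
  (bounded_U : [bounded u | u in U])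
  (convex_U : convex_set (U : set (convex_lmodType 'rV[R]_m)))
  (f : 'I_q -> R -> 'rV[R]_n -> 'rV[R]_m -> 'rV[R]_n)
  (f_diff_x : forall i t x u, differentiable (fun y => f i t y u) x)
  (f_diff_u : forall i t x u, differentiable (fun v => f i t x v) u)
  (L : R) (L_gt0 : 0 < L)
  (f_lip : forall i, lipschitz_data (@norm2 R n) U L (f i))
  (f_lip_x : forall i, lipschitz_data (@mx_norm2 R n n) U L
     (fun t x u => jacobian (fun y => f i t y u) x))
  (f_lip_u : forall i, lipschitz_data (@mx_norm2 R m n) U L
     (fun t x u => jacobian (fun v => f i t x v) u)) :
  exists K : R, 0 < K /\
    forall (N : nat) (xi : (R -> 'rV[R]_m) * (R -> 'rV[R]_q)) (t : R),
      Xr U xi -> 0 <= t <= 1 ->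
      norm2 (phi f x0 t (rho N xi) - phi f x0 t xi) <=
        K * (1 / Num.sqrt 2) ^+ N * (BVnorm_pair xi + 1).
Proof.
pose Lam0 := L * (n + m).+1%:R.
have Lam0_gt0 : 0 < Lam0 by rewrite mulr_gt0.
have fU : sup_lipschitz f (closure U) Lam0.
  by apply: sup_lipschitz_closure => //; exact: lipschitz_data_sup.
have [C0 C0_ge0 fC] := bounded_field_closure x0 Lam0_gt0 bounded_U fU.
pose a := gap_slope m q Lam0 C0; pose b := gap_offset q Lam0 C0.
pose W := weight (q%:R * Lam0) 1.
have W0 : 0 <= W by exact: expR_ge0.
have qL0 : 0 <= q%:R * Lam0 by rewrite mulr_ge0// ltW.
have Cg0 : 0 <= C0 + Lam0 * (2 * (q%:R * C0) * W).
  by rewrite addr_ge0// mulr_ge0 ?(ltW Lam0_gt0)// !mulr_ge0.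
have a0 : 0 <= a by rewrite /a /gap_slope !addr_ge0// ?mulr_ge0// ltW.
have b0 : 0 <= b.
  rewrite /b /gap_offset addr_ge0// mulr_ge0 ?(ltW Lam0_gt0)// addr_ge0//.
  have qC0 : 0 <= q%:R * C0 by exact: mulr_ge0.
  apply: addr_ge0 => //; apply: mulr_ge0 => //.
  by apply: mulr_ge0; [exact: mulr_ge0|exact: expR_ge0].
(* [n] comes from the passage to the Euclidean norm and [m + q] from the bound
   of [v 1 - v 0] by the total variation *)
pose c := n%:R * (2 * (q%:R * (a * (m + q)%:R + b)) * W).
have c0 : 0 <= c by rewrite !mulr_ge0// addr_ge0// mulr_ge0.
exists (c + 1); split; first by rewrite ltr_pwDr.
move=> N xi t [[uU _ bu] [dS _ bd]] t01.
have [v [vu vd v01 V0]] := pair_variation_bound bu bd.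
have H := trajectory_gap convex_U vu vd uU dS Lam0_gt0 C0_ge0 q_gt0 fU fC N t01.
rewrite (le_trans (norm2_le_norm _))//.
set V := BVnorm_pair xi in v01 V0 *.
set h : R := (2 ^ N)%:R^-1 in H.
have h0 : 0 <= h by rewrite invr_ge0.
have hr : h <= (1 / Num.sqrt 2) ^+ N.
  rewrite /h natrX -exprVn div1r; apply: lerXn2r; rewrite ?nnegrE ?invr_ge0 ?sqrtr_ge0//.
  rewrite lef_pV2 ?posrE ?sqrtr_gt0//.
  rewrite -[leRHS]sqr_sqrtr// expr2 ler_peMr ?sqrtr_ge0//.
  by rewrite -[leLHS]sqrtr1 ler_sqrt// ler1n.
apply: (@le_trans _ _ (n%:R * (2 * (h * (q%:R * (a * (v 1 - v 0) + b))) * W))).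
  by rewrite ler_wpM2l.
apply: (@le_trans _ _ (h * (c * (V + 1)))).
  rewrite (_ : n%:R * _ = h * (n%:R * (2 * (q%:R * (a * (v 1 - v 0) + b)) * W))); last by ring.
  have -> : c * (V + 1) = n%:R * (2 * (q%:R * ((a * (m + q)%:R + b) * (V + 1))) * W).
    by rewrite /c; ring.
  do 2 (apply: ler_wpM2l => //); apply: ler_wpM2r => //; do 2 apply: ler_wpM2l => //.
  rewrite [leRHS]mulrDl lerD//.
    rewrite -mulrA ler_wpM2l// (le_trans v01)// ler_wpM2l//.
    by rewrite lerDl.
  by rewrite ler_peMr// lerDr.
rewrite mulrA ler_wpM2r ?addr_ge0// mulrC ler_pM//.
by rewrite lerDl.
Qed.
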